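(* Let $\mathcal A$ be a CQG algebra. Then the mapping $a\mapsto a^-:\mathcal A\to\mathcal A$ defined by $$a^-:=f_{1/2}.a^*.f_{-1/2}\qquad(a\in\mathcal A)$$ is an involution on $\mathcal A$ (an involutive, antilinear, antimultiplicative map) such that $$(f_{-1/4}.a.f_{1/4})^*=f_{-1/4}.a^-.f_{1/4}\qquad(a\in\mathcal A).$$ The Hopf algebra $\mathcal A$, together with the involution $a\mapsto a^-$, is a Hopf $*$-algebra. Furthermore, if $\mathcal A$ is considered as a Hopf $*$-algebra with respect to the (original) involution $a\mapsto a^*$ and if $t=(t_{ij})$ is a unitary matrix corepresentation of $\mathcal A$, then the matrix corepresentation $t^-:=((t_{ij})^-)$ of $\mathcal A$ is equivalent to the matrix corepresentation $t^*:=((t_{ij})^* )$ and is unitary.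
   Context: All algebras are complex, associative and unital. A Hopf $*$-algebra is a Hopf algebra $\mathcal A$ (comultiplication $\Delta$, counit $\varepsilon$, antipode $S$) with an involutive antilinear antimultiplicative map $a\mapsto a^*$ such that $\Delta$ and $\varepsilon$ are $*$-homomorphisms (with $(a\otimes b)^*=a^*\otimes b^*$). The algebraic linear dual is $\mathcal A^*$. For $f\in\mathcal A^*$, $a\in\mathcal A$ put $f.a:=(\mathrm{id}\otimes f)(\Delta(a))$ and $a.f:=(f\otimes\mathrm{id})(\Delta(a))$; these left and right actions commute. A matrix corepresentation of $\mathcal A$ is a square matrix $t=(t_{ij})$ over $\mathcal A$ with $\Delta(t_{ij})=\sum_k t_{ik}\otimes t_{kj}$ and $\varepsilon(t_{ij})=\delta_{ij}$; it is unitary if $S(t_{ij})=(t_{ji})^*$. Matrix corepresentations $s,t$ of the same dimension are equivalent if $Bs=tB$ for some invertible complex matrix $B$; $t$ is irreducible if it is not equivalent to one of block form $\left(\begin{smallmatrix}*&*\\0&*\end{smallmatrix}\right)$ with nontrivial blocks. A CQG algebra is a Hopf $*$-algebra that is the linear span of the matrix elements of its unitary matrix corepresentations. For a CQG algebra $\mathcal A$, $\widehat{\mathcal A}$ denotes the set of equivalence classes of irreducible unitary matrix corepresentations; for each $\alpha\in\widehat{\mathcal A}$ a unitary representative $t^\alpha=(t_{ij}^\alpha)_{i,j=1,\dots,d_\alpha}$ is chosen; all $t_{ij}^\alpha$ together form a basis of $\mathcal A$. The matrix $t''$ with entries $S^2(t_{ij}^\alpha)$ is equivalent to $t^\alpha$,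 and $F_\alpha$ denotes the unique invertible complex matrix with $F_\alpha t^\alpha=t''F_\alpha$ and $\operatorname{tr}F_\alpha=\operatorname{tr}F_\alpha^{-1}>0$; it is positive definite. For $z\in\mathbb C$, the linear functional $f_z\in\mathcal A^*$ is defined by $f_z(t_{ij}^\alpha):=(F_\alpha^z)_{ij}$. *)

(* Defs.v *)
From HB Require Import structures.
From mathcomp Require Import all_boot all_order all_algebra.
From mathcomp Require Import generic_quotient complex.
From mathcomp Require Import boolp reals sequences exp trigo.

Set Implicit Arguments.
Unset Strict Implicit.
Unset Printing Implicit Defensive.

Import Order.TTheory GRing.Theory Num.Theory.

Local Open Scope ring_scope.
Local Open Scope quotient_scope.

Reserved Notation "x \ox y" (at level 39, left associativity).

Section TensorProduct.
Variables (K : comNzRingType) (V W : lmodType K).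

(* A sequence of pairs stands for the corresponding sum of pure tensors;
   [teq] is the congruence generated by the bilinear relations. *)
Inductive teq : seq (V * W) -> seq (V * W) -> Prop :=
| teq_refl s : teq s s
| teq_sym s t : teq s t -> teq t s
| teq_trans s t u : teq s t -> teq t u -> teq s u
| teq_cat s s' t t' : teq s s' -> teq t t' -> teq (s ++ t) (s' ++ t')
| teq_catC s t : teq (s ++ t) (t ++ s)
| teq_0 w : teq [:: (0, w)] [::]
| teq_Dl v v' w : teq [:: (v + v', w)] [:: (v, w); (v', w)]
| teq_Dr v w w' : teq [:: (v, w + w')] [:: (v, w); (v, w')]
| teq_Z k v w : teq [:: (k *: v, w)] [:: (v, k *: w)].

Definition teqb : rel (seq (V * W)) := fun s t => `[< teq s t >].

Lemma teqb_refl : reflexive teqb.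
Proof. by move=> s; apply/asboolP; apply: teq_refl. Qed.

Lemma teqb_sym : symmetric teqb.
Proof. by move=> s t; apply/asboolP/asboolP; apply: teq_sym. Qed.

Lemma teqb_trans : transitive teqb.
Proof.
move=> t s u /asboolP st /asboolP tu; apply/asboolP; exact: teq_trans st tu.
Qed.

Canonical teqb_equiv := EquivRel teqb teqb_refl teqb_sym teqb_trans.

Definition tensor := {eq_quot teqb}.
HB.instance Definition _ := Choice.on tensor.
HB.instance Definition _ := EqQuotient.on tensor.

Lemma tensorP s t : teq s t <-> \pi_tensor s = \pi_tensor t.
Proof.
split; first by move=> st; apply/eqmodP/asboolP.
by move/eqmodP/asboolP.
Qed.

Lemma teq_repr s : teq (repr (\pi_tensor s)) s.
Proof. by apply/tensorP; rewrite reprK. Qed.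

Definition tpure (v : V) (w : W) : tensor := \pi_tensor [:: (v, w)].
Local Notation "v \ox w" := (tpure v w).

Definition tzero : tensor := \pi_tensor [::].
Definition tadd (x y : tensor) : tensor := \pi_tensor (repr x ++ repr y).
Definition tscale_seq (k : K) (s : seq (V * W)) := [seq (k *: p.1, p.2) | p <- s].
Definition tscale (k : K) (x : tensor) : tensor := \pi_tensor (tscale_seq k (repr x)).
Definition topp (x : tensor) : tensor := tscale (-1) x.

Lemma tadd_pi s t : tadd (\pi_tensor s) (\pi_tensor t) = \pi_tensor (s ++ t).
Proof. by apply/tensorP; apply: teq_cat; apply: teq_repr. Qed.

Lemma teq_scale k s t : teq s t -> teq (tscale_seq k s) (tscale_seq k t).
Proof.
elim=> {s t} [s|s t _|s t u _ st _|s s' t t' _ IHs _ IHt|s t|w|v v' w|v w w'|l v w].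
- exact: teq_refl.
- exact: teq_sym.
- exact: teq_trans.
- by rewrite /tscale_seq !map_cat; apply: teq_cat.
- by rewrite /tscale_seq !map_cat; apply: teq_catC.
- by rewrite /= scaler0; apply: teq_0.
- by rewrite /= scalerDr; apply: teq_Dl.
- exact: teq_Dr.
- by rewrite /= !scalerA mulrC -scalerA; apply: teq_Z.
Qed.

Lemma tscale_pi k s : tscale k (\pi_tensor s) = \pi_tensor (tscale_seq k s).
Proof. by apply/tensorP; apply: teq_scale; apply: teq_repr. Qed.

Lemma tensor_ind_pi (P : tensor -> Prop) :
  (forall s, P (\pi_tensor s)) -> forall x, P x.
Proof. by move=> Ppi x; rewrite -[x]reprK. Qed.

Lemma taddA : associative tadd.
Proof.
elim/tensor_ind_pi=> s; elim/tensor_ind_pi=> t; elim/tensor_ind_pi=> u.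
by rewrite !tadd_pi catA.
Qed.

Lemma taddC : commutative tadd.
Proof.
elim/tensor_ind_pi=> s; elim/tensor_ind_pi=> t.
by rewrite !tadd_pi; apply/tensorP; apply: teq_catC.
Qed.

Lemma tadd0 : left_id tzero tadd.
Proof. by elim/tensor_ind_pi=> s; rewrite tadd_pi. Qed.

Lemma taddN : left_inverse tzero topp tadd.
Proof.
elim/tensor_ind_pi=> s; rewrite /topp tscale_pi tadd_pi; apply/tensorP.
elim: s => [|[v w] s IHs] /=; first exact: teq_refl.
apply: (@teq_trans _ ([:: (-1 *: v, w); (v, w)] ++ (tscale_seq (-1) s ++ s))).
  rewrite -[_ :: _ ++ _]/([:: (-1 *: v, w)] ++ _).
  rewrite -[[:: _; _]]/([:: (-1 *: v, w)] ++ [:: (v, w)]) -[in X in teq _ X]catA.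
  apply: teq_cat; first exact: teq_refl.
  rewrite -[(v, w) :: s]/([:: (v, w)] ++ s) !catA.
  by apply: teq_cat; [apply: teq_catC | apply: teq_refl].
rewrite -[X in teq _ X]/([::] ++ [::]); apply: teq_cat => //.
apply: teq_trans (teq_0 w); apply: teq_sym.
by rewrite -[X in (X, w)](addNr v) -scaleN1r; apply: teq_Dl.
Qed.

HB.instance Definition _ := GRing.isZmodule.Build tensor taddA taddC tadd0 taddN.

Lemma tpiD s t : \pi_tensor (s ++ t) = \pi_tensor s + \pi_tensor t.
Proof. by rewrite -tadd_pi. Qed.

Lemma tpi0 : \pi_tensor [::] = 0. Proof. by []. Qed.

Lemma tpiE s : \pi_tensor s = \sum_(p <- s) p.1 \ox p.2.
Proof.
elim: s => [|[v w] s IHs]; first by rewrite big_nil tpi0.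
by rewrite big_cons -IHs -tpiD.
Qed.

Lemma tensorE x : x = \sum_(p <- repr x) p.1 \ox p.2.
Proof. by rewrite -tpiE reprK. Qed.

Lemma tpureDl v v' w : (v + v') \ox w = v \ox w + v' \ox w.
Proof. by rewrite -tpiD; apply/tensorP; apply: teq_Dl. Qed.

Lemma tpureDr v w w' : v \ox (w + w') = v \ox w + v \ox w'.
Proof. by rewrite -tpiD; apply/tensorP; apply: teq_Dr. Qed.

Lemma tpureZ k v w : (k *: v) \ox w = v \ox (k *: w).
Proof. by apply/tensorP; apply: teq_Z. Qed.

Lemma tscaleA k l x : tscale k (tscale l x) = tscale (k * l) x.
Proof.
elim/tensor_ind_pi: x => s; rewrite !tscale_pi /tscale_seq -map_comp.
by congr (\pi_tensor _); apply: eq_map => p /=; rewrite scalerA.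
Qed.

Lemma tscale1 : left_id 1 tscale.
Proof.
elim/tensor_ind_pi=> s; rewrite tscale_pi /tscale_seq.
by congr (\pi_tensor _); rewrite -[RHS]map_id; apply: eq_map => -[v w]; rewrite /= scale1r.
Qed.

Lemma tscaleDr : right_distributive tscale +%R.
Proof.
move=> k; elim/tensor_ind_pi=> s; elim/tensor_ind_pi=> t.
by rewrite -tpiD !tscale_pi /tscale_seq map_cat tpiD.
Qed.

Lemma tscaleDl x : {morph tscale^~ x : k l / k + l}.
Proof.
move=> k l; elim/tensor_ind_pi: x => s; rewrite !tscale_pi !tpiE !big_map.
by rewrite -big_split; apply: eq_bigr => p _ /=; rewrite scalerDl tpureDl.
Qed.

HB.instance Definition _ := GRing.Zmodule_isLmodule.Build K tensor
  tscaleA tscale1 tscaleDr tscaleDl.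

Lemma tpureZl k v w : (k *: v) \ox w = k *: (v \ox w).
Proof. by rewrite [RHS]tscale_pi. Qed.

Lemma tpureZr k v w : v \ox (k *: w) = k *: (v \ox w).
Proof. by rewrite -tpureZ tpureZl. Qed.

Lemma tpure0l w : 0 \ox w = 0.
Proof. by rewrite -(scale0r 0) tpureZl scale0r. Qed.

Lemma tpure0r v : v \ox 0 = 0.
Proof. by rewrite -(scale0r 0) tpureZr scale0r. Qed.

(* The linear map induced by b; meaningful when b is bilinear. *)
Definition tlift (U : nmodType) (b : V -> W -> U) (x : tensor) : U :=
  \sum_(p <- repr x) b p.1 p.2.

(* Well defined as soon as b is biadditive and K-balanced. *)
Lemma tlift_pi (U : nmodType) (b : V -> W -> U) :
  (forall w, b 0 w = 0) ->
  (forall v v' w, b (v + v') w = b v w + b v' w) ->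
  (forall v w w', b v (w + w') = b v w + b v w') ->
  (forall k v w, b (k *: v) w = b v (k *: w)) ->
  forall s, tlift b (\pi_tensor s) = \sum_(p <- s) b p.1 p.2.
Proof.
move=> b0 bDl bDr bZ s; rewrite /tlift.
suff teq_sum s1 s2 : teq s1 s2 ->
    \sum_(p <- s1) b p.1 p.2 = \sum_(p <- s2) b p.1 p.2.
  exact/teq_sum/teq_repr.
elim=> {s s1 s2} [s|s t _ ->|s t u _ -> _ ->|s s' t t' _ IHs _ IHt|s t
  |w|v v' w|v w w'|k v w] //.
- by rewrite !big_cat IHs IHt.
- by rewrite !big_cat /= addrC.
- by rewrite big_seq1 big_nil.
- by rewrite big_seq1 big_cons big_seq1 /= bDl.
- by rewrite big_seq1 big_cons big_seq1 /= bDr.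
- by rewrite !big_seq1 /= bZ.
Qed.

End TensorProduct.

Notation "v \ox w" := (tpure v w) : ring_scope.

Section TensorUniversal.
Variables (K : comNzRingType) (V W U : lmodType K) (b : V -> W -> U).
Hypothesis b_linl : forall w, linear (b^~ w).
Hypothesis b_linr : forall v, linear (b v).

Let blP k v v' w : b (k *: v + v') w = k *: b v w + b v' w.
Proof. exact: b_linl. Qed.

Let brP k v w w' : b v (k *: w + w') = k *: b v w + b v w'.
Proof. exact: b_linr. Qed.

Let b0l w : b 0 w = 0.
Proof. by have := blP (-1) 0 0 w; rewrite !scaleN1r oppr0 addr0 addNr. Qed.

Let b0r v : b v 0 = 0.
Proof. by have := brP (-1) v 0 0; rewrite !scaleN1r oppr0 addr0 addNr. Qed.

Let bDl v v' w : b (v + v') w = b v w + b v' w.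
Proof. by rewrite -[v in LHS]scale1r blP scale1r. Qed.

Let bDr v w w' : b v (w + w') = b v w + b v w'.
Proof. by rewrite -[w in LHS]scale1r brP scale1r. Qed.

Let bZl k v w : b (k *: v) w = k *: b v w.
Proof. by rewrite -[k *: v]addr0 blP b0l addr0. Qed.

Let bZr k v w : b v (k *: w) = k *: b v w.
Proof. by rewrite -[k *: w]addr0 brP b0r addr0. Qed.

Let bZ k v w : b (k *: v) w = b v (k *: w).
Proof. by rewrite bZl bZr. Qed.

Let tlift_piE := tlift_pi b0l bDl bDr bZ.

Lemma tlift_pure v w : tlift b (v \ox w) = b v w.
Proof. by rewrite /tpure tlift_piE big_seq1. Qed.

Lemma tlift_linear : linear (tlift b).
Proof.
move=> k; elim/tensor_ind_pi=> s; elim/tensor_ind_pi=> t.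
rewrite [k *: _]tscale_pi -tpiD !tlift_piE big_cat big_map scaler_sumr.
by congr (_ + _); apply: eq_bigr => p _; rewrite bZl.
Qed.

Lemma tlift_unique (g : {linear tensor V W -> U}) :
  (forall v w, g (v \ox w) = b v w) -> g =1 tlift b.
Proof.
by move=> gb x; rewrite [in LHS](tensorE x) linear_sum; apply: eq_bigr => p _.
Qed.

End TensorUniversal.

(* (f (x) g); meaningful when f and g are both linear or both antilinear. *)
Definition tmap (K : comNzRingType) (V W V' W' : lmodType K)
    (f : V -> V') (g : W -> W') : tensor V W -> tensor V' W' :=
  tlift (fun v w => f v \ox g w).

Definition tassoc (K : comNzRingType) (U V W : lmodType K) :
    tensor (tensor U V) W -> tensor U (tensor V W) :=
  tlift (fun x w => tlift (fun u v => u \ox (v \ox w)) x).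

Section TensorAlgebra.
Variables (K : comNzRingType) (A B : algType K).

Definition tone : tensor A B := 1 \ox 1.
Definition tmul (x y : tensor A B) : tensor A B :=
  tlift (fun a b => tlift (fun a' b' => (a * a') \ox (b * b')) y) x.

Let mulr_linl (a : A) (b : B) b' :
  linear (fun a' => (a * a') \ox (b * b') : tensor A B).
Proof. by move=> k u v; rewrite mulrDr -scalerAr tpureDl tpureZl. Qed.

Let mulr_linr (a : A) (b : B) a' :
  linear (fun b' => (a * a') \ox (b * b') : tensor A B).
Proof. by move=> k u v; rewrite mulrDr -scalerAr tpureDr tpureZr. Qed.

Let inner_linear a b := tlift_linear (mulr_linl a b) (mulr_linr a b).

Let innerE a b y : tlift (fun a' b' => (a * a') \ox (b * b')) y =
  \sum_(p <- repr y) (a * p.1) \ox (b * p.2) :> tensor A B.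
Proof. by []. Qed.

Let outer_linl y b :
  linear (fun a => tlift (fun a' b' => (a * a') \ox (b * b')) y : tensor A B).
Proof.
move=> k u v; rewrite !innerE scaler_sumr -big_split; apply: eq_bigr => p _ /=.
by rewrite mulrDl -scalerAl tpureDl tpureZl.
Qed.

Let outer_linr y a :
  linear (fun b => tlift (fun a' b' => (a * a') \ox (b * b')) y : tensor A B).
Proof.
move=> k u v; rewrite !innerE scaler_sumr -big_split; apply: eq_bigr => p _ /=.
by rewrite mulrDl -scalerAl tpureDr tpureZr.
Qed.

Lemma tmul_pure a b a' b' :
  tmul (a \ox b) (a' \ox b') = (a * a') \ox (b * b').
Proof.
rewrite /tmul (tlift_pure (outer_linl _) (outer_linr _)).
by rewrite (tlift_pure (mulr_linl _ _) (mulr_linr _ _)).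
Qed.

Lemma tmul_linl y : linear (tmul^~ y).
Proof. exact: (tlift_linear (outer_linl y) (outer_linr y)). Qed.

Lemma tmul_linr x : linear (tmul x).
Proof.
move=> k u v; rewrite /tmul /tlift scaler_sumr -big_split.
by apply: eq_bigr => p _; apply: inner_linear.
Qed.

Lemma tmulDl : left_distributive tmul +%R.
Proof. by move=> x y z; rewrite -[x in LHS]scale1r tmul_linl scale1r. Qed.

Lemma tmulDr : right_distributive tmul +%R.
Proof. by move=> z x y; rewrite -[x in LHS]scale1r tmul_linr scale1r. Qed.

Lemma tmul0l y : tmul 0 y = 0.
Proof. by apply: (addrI (tmul 0 y)); rewrite -tmulDl !addr0. Qed.

Lemma tmul0r x : tmul x 0 = 0.
Proof. by apply: (addrI (tmul x 0)); rewrite -tmulDr !addr0. Qed.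

Lemma tmul_suml I (r : seq I) (F : I -> tensor A B) y :
  tmul (\sum_(i <- r) F i) y = \sum_(i <- r) tmul (F i) y.
Proof. exact: (big_morph (tmul^~ y) (fun u v => tmulDl u v y) (tmul0l y)). Qed.

Lemma tmul_sumr I (r : seq I) (F : I -> tensor A B) x :
  tmul x (\sum_(i <- r) F i) = \sum_(i <- r) tmul x (F i).
Proof. exact: (big_morph (tmul x) (tmulDr x) (tmul0r x)). Qed.

Lemma tmulA : associative tmul.
Proof.
move=> x y z; rewrite (tensorE x) !tmul_suml; apply: eq_bigr => p _.
rewrite (tensorE y) !(tmul_suml, tmul_sumr); apply: eq_bigr => q _.
rewrite (tensorE z) !tmul_sumr; apply: eq_bigr => r _.
by rewrite !tmul_pure !mulrA.
Qed.

Lemma tmul1 : left_id tone tmul.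
Proof.
move=> x; rewrite (tensorE x) tmul_sumr; apply: eq_bigr => p _.
by rewrite tmul_pure !mul1r.
Qed.

Lemma tmulr1 : right_id tone tmul.
Proof.
move=> x; rewrite (tensorE x) tmul_suml; apply: eq_bigr => p _.
by rewrite tmul_pure !mulr1.
Qed.

HB.instance Definition _ := GRing.Zmodule_isPzRing.Build (tensor A B)
  tmulA tmul1 tmulr1 tmulDl tmulDr.

End TensorAlgebra.

HB.mixin Record isHopf (K : fieldType) A of GRing.Algebra K A := {
  comul : A -> tensor A A;
  counit : A -> K;
  antipode : A -> A;
  comul_linear : linear comul;
  comul_monoid : monoid_morphism comul;
  counit_linear : scalar counit;
  counit_monoid : monoid_morphism counit;
  antipode_linear : linear antipode;
  comulA : forall a, tassoc (tmap comul id (comul a)) = tmap id comul (comul a);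
  counitl : forall a, tlift (fun x y => counit x *: y) (comul a) = a;
  counitr : forall a, tlift (fun x y => counit y *: x) (comul a) = a;
  antipodel : forall a, tlift (fun x y => antipode x * y) (comul a) = (counit a)%:A;
  antipoder : forall a, tlift (fun x y => x * antipode y) (comul a) = (counit a)%:A
}.

#[short(type="hopfAlgType")]
HB.structure Definition HopfAlgebra (K : fieldType) :=
  {A of GRing.Algebra K A & isHopf K A}.

Section HopfAction.
Variables (K : fieldType) (A : hopfAlgType K).

(* lact f a is f.a and ract a f is a.f *)
Definition lact (f : {scalar A}) (a : A) : A :=
  tlift (fun x y => f y *: x) (comul a).
Definition ract (a : A) (f : {scalar A}) : A :=
  tlift (fun x y => f x *: y) (comul a).

End HopfAction.

Section Corepresentations.
Variables (K : fieldType) (A : hopfAlgType K).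

Definition corep n (t : 'M[A]_n) : Prop :=
  (forall i j, comul (t i j) = \sum_k t i k \ox t k j) /\
  (forall i j, counit (t i j) = (i == j)%:R).

Definition scalmx m n (B : 'M[K]_(m, n)) : 'M[A]_(m, n) :=
  map_mx (in_alg A) B.

Definition corep_equiv n (s t : 'M[A]_n) : Prop :=
  exists2 B : 'M[K]_n, B \in unitmx & scalmx B *m s = t *m scalmx B.

(* The 0-dimensional corepresentation is not counted as irreducible. *)
Definition corep_irr n (t : 'M[A]_n) : Prop :=
  [/\ (0 < n)%N, corep t &
    ~ exists (p q : nat) (e : n = (p + q)%N) (s : 'M[A]_(p + q)),
      [/\ (0 < p)%N, (0 < q)%N, corep_equiv (castmx (e, e) t) s &
          dlsubmx s = 0]].

Definition lin_span (X : A -> Prop) (a : A) : Prop :=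
  exists (m : nat) (c : 'I_m -> K) (x : 'I_m -> A),
    (forall i, X (x i)) /\ a = \sum_i c i *: x i.

End Corepresentations.

Section HopfStar.
Variables (C : numClosedFieldType) (A : hopfAlgType C).

Definition is_involution (st : A -> A) : Prop :=
  [/\ involutive st,
      forall (k : C) a b, st (k *: a + b) = k^* *: st a + st b &
      forall a b, st (a * b) = st b * st a].

Definition is_hopf_star (st : A -> A) : Prop :=
  [/\ is_involution st,
      forall a, comul (st a) = tmap st st (comul a) &
      forall a, counit (st a) = (counit a)^*].

Definition unitary_corep (st : A -> A) n (t : 'M[A]_n) : Prop :=
  corep t /\ forall i j, antipode (t i j) = st (t j i).

Definition is_cqg (st : A -> A) : Prop :=
  is_hopf_star st /\
  forall a, lin_span (fun x => exists (n : nat) (t : 'M[A]_n) (i j : 'I_n),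
                        unitary_corep st t /\ x = t i j) a.

(* One unitary representative t i for each equivalence class of irreducible
   unitary matrix corepresentations. *)
Definition irr_unitary_system (st : A -> A) (I : Type) (d : I -> nat)
    (t : forall i, 'M[A]_(d i)) : Prop :=
  [/\ forall i, unitary_corep st (t i) /\ corep_irr (t i),
      forall n (s : 'M[A]_n), unitary_corep st s -> corep_irr s ->
        exists (i : I) (e : d i = n), corep_equiv (castmx (e, e) (t i)) s &
      forall (i j : I) (e : d i = d j),
        corep_equiv (castmx (e, e) (t i)) (t j) -> i = j].

Definition antipode2_intertwiner n (t : 'M[A]_n) (F : 'M[C]_n) : Prop :=
  [/\ F \in unitmx,
      scalmx A F *m t = map_mx (fun a => antipode (antipode a)) t *m scalmx A F,
      \tr F = \tr (invmx F) & 0 < \tr F].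

End HopfStar.

Section ComplexPower.
Variable R : realType.
Local Open Scope complex_scope.

Definition cexp (z : R[i]) : R[i] :=
  let: x +i* y := z in (expR x * cos y) +i* (expR x * sin y).

(* l^z := exp (z ln l); meaningful for real positive l only. *)
Definition cpow (l z : R[i]) : R[i] := cexp (z * (ln (complex.Re l))%:C).

(* Functional calculus on F = P^-1 diag(l) P with P unitary, which the library
   provides for normal F; meaningful for positive definite F. *)
Definition mxcpow n (F : 'M[R[i]]_n) (z : R[i]) : 'M[R[i]]_n :=
  invmx (spectralmx F)
  *m diag_mx (map_mx (cpow^~ z) (spectral_diag F))
  *m spectralmx F.

End ComplexPower.

(* Main.v *)
Require Import Defs.
From HB Require Import structures.
From mathcomp Require Import all_boot all_order all_algebra.
From mathcomp Require Import ring mxtens complex.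
From mathcomp Require Import boolp classical_sets reals exp trigo.

(** Write [X] for a complex matrix X viewed over A, u* for the matrix of the
    (u i j)^*, X† for a conjugate transpose, and S²(u) for the entrywise double
    antipode of u.

    The heart of the matter is that every f_z is a character of A (power_mul).
    The entries of unitary corepresentations u span A, so the claims only have
    to be checked on them, and there they are matrix algebra. There is a
    positive definite G with [G] u = S²(u) [G] and f_z(u) = G^z. As S(u) is the
    inverse of u and the transpose of u*, a character takes u* to
    f_z(u* ) = (G^(-z))^T. Hence a |-> a^- sends the entries of u to those of
    [(G^(1/2))^T] u* [(G^(-1/2))^T] (bar_unitary), a corepresentation
    equivalent to u*, which is unitary because
    S(u* ) = S²(u)^T = [(G^(-1))^T] u^T [G^T].

    To prove that f_z is multiplicative, call G normalized for u if in addition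
    tr(T G) = tr(T G^(-1)) for every endomorphism T of u. A normalized G is
    unique (normalized_uniq): for another one H, the matrices H G^(-1) and
    H^(-1) G are endomorphisms, the normalizations make their difference X
    satisfy tr(X G X†) = 0, and so H² = G². Schur's lemma makes F_alpha
    normalized for t^alpha as soon as it is positive definite, and splitting u
    into irreducible summands gives f_z(u) = G^z for every unitary u and its
    normalized G (normalized_power). Finally, if G and H are
    normalized for u and w, then their Kronecker product is normalized for the
    tensor product of u and w (normalized_tens): the partial traces
    (id (x) tr)(T (1 (x) H)) and (tr (x) id)(T (G^(-1) (x) 1)) of an
    endomorphism T are endomorphisms of u and w, so the exponents in
    tr(T (G (x) H)) may be changed in one factor at a time. As the z-th
    power of the Kronecker product is the Kronecker product of the z-th powers,
    f_z(a b) = f_z(a) f_z(b) for entries a of u and b of w.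

    It remains to see that F_alpha is positive definite (intertwiner_posdef).
    For t = t^alpha, some unitary u admits a matrix T <> 0 with
    [T] t* = u [T] (corep_to_unitary); since S and the adjoint agree on u, this
    yields [P] t = S²(t) [P] for P = (T† T)^T, and by Schur's lemma F_alpha is
    a multiple of P, a positive one because its trace is positive. To find T,
    choose u such that the entries of t* are linear combinations of those of u.
    The matrices phi(u), phi running over the linear functionals of A, form a
    subspace closed under adjoints; projecting orthogonally onto it provides
    functionals psi_m with phi(t* 0 m) = tr(psi_m(u) phi(u)) for all
    phi, and then a fixed column of the psi_m(u) is such a T. *)

Set Implicit Arguments.
Unset Strict Implicit.
Unset Printing Implicit Defensive.

Import Order.TTheory GRing.Theory Num.Theory.
Local Open Scope ring_scope.
Local Open Scope sesquilinear_scope.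

(** * Functional calculus of positive definite matrices *)
Section FunctionalCalculus.
Variable C : numClosedFieldType.

(** A function of a diagonalizable matrix does not depend on the chosen
    diagonalization. The change of basis X = W' W^-1 intertwines the two
    diagonal matrices, so X i j can be nonzero only if l' i = l j, and then
    also g (l' i) = g (l j). *)
Lemma diag_conj_calculus n (W W' : 'M[C]_n) (l l' : 'rV[C]_n) (g : C -> C) :
  W \in unitmx -> W' \in unitmx ->
  invmx W *m diag_mx l *m W = invmx W' *m diag_mx l' *m W' ->
  invmx W *m diag_mx (map_mx g l) *m W =
  invmx W' *m diag_mx (map_mx g l') *m W'.
Proof.
move=> uW uW' e; pose X := W' *m invmx W.
have eX : X *m diag_mx l = diag_mx l' *m X.
  have := congr1 (fun Z => W' *m Z *m invmx W) e.
  by rewrite !mulmxA mulmxV // mul1mx mulmxK // /X !mulmxA.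
have eg : X *m diag_mx (map_mx g l) = diag_mx (map_mx g l') *m X.
  apply/matrixP => i j; move/matrixP/(_ i j): eX.
  rewrite !mul_mx_diag !mul_diag_mx !mxE.
  have [->|nz] := eqVneq (\sum_k W' i k * invmx W k j) 0.
    by rewrite !mul0r !mulr0.
  rewrite [X in _ = X -> _]mulrC => /(mulfI nz) ->.
  by rewrite mulrC.
have := congr1 (fun Z => invmx W' *m Z *m W) eg.
by rewrite /X !mulmxA mulVmx // mul1mx mulmxKV.
Qed.

(** Encoded by a unitary diagonalization: conjugates, direct sums, Kronecker
    products and powers can then be read off on the diagonal. *)
Definition posdef n (G : 'M[C]_n) : Prop := exists (W : 'M[C]_n) (l : 'rV[C]_n),
  [/\ W \is unitarymx, forall j, 0 < l 0 j & G = invmx W *m diag_mx l *m W].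

Lemma diag_mx_unit n (l : 'rV[C]_n) :
  (forall j, l 0 j != 0) -> diag_mx l \in unitmx.
Proof.
move=> nz; suff : diag_mx l *m diag_mx (map_mx (@GRing.inv C) l) = 1%:M.
  by case/mulmx1_unit.
rewrite mulmx_diag -diag_const_mx; congr diag_mx.
by apply/rowP => j; rewrite !mxE divff.
Qed.

Lemma posdef_unit n (G : 'M[C]_n) : posdef G -> G \in unitmx.
Proof.
move=> [W [l [Wu lp ->]]]; rewrite !unitmx_mul unitmx_inv unitarymx_unit //=.
by rewrite andbT diag_mx_unit // => j; rewrite gt_eqF.
Qed.

Lemma posdef_herm n (G : 'M[C]_n) : posdef G -> G^t* = G.
Proof.
move=> [W [l [Wu lp ->]]]; rewrite invmx_unitary // !trmx_mul !map_mxM.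
rewrite trmxCK mulmxA tr_diag_mx map_diag_mx; congr (_ *m diag_mx _ *m _).
by apply/rowP => j; rewrite mxE; apply/CrealP/gtr0_real.
Qed.

Lemma mxtrace_adj_ge0 m n (X : 'M[C]_(m, n)) : 0 <= \tr (X *m X^t*).
Proof.
apply: sumr_ge0 => i _; rewrite mxE; apply: sumr_ge0 => j _.
by rewrite !mxE mul_conjC_ge0.
Qed.

(** In a basis where G is diagonal, the trace is a sum of terms |Y i j|² l j
    with all l j positive, where Y = X W^-1. *)
Lemma posdef_trace_eq0 m n (X : 'M[C]_(m, n)) (G : 'M[C]_n) :
  posdef G -> \tr (X *m G *m X^t*) = 0 -> X = 0.
Proof.
move=> [W [l [Wu lp ->]]]; pose Y := X *m invmx W.
have -> : X *m (invmx W *m diag_mx l *m W) *m X^t* = Y *m diag_mx l *m Y^t*.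
  by rewrite /Y invmx_unitary // !trmx_mul !map_mxM trmxCK !mulmxA.
move=> tr0; suff Y0 : Y = 0.
  by rewrite -[X](mulmxKV (unitarymx_unit Wu)) -/Y Y0 mul0mx.
have ge0 i j : 0 <= (Y *m diag_mx l) i j * (Y^t*) j i.
  by rewrite mul_mx_diag !mxE mulrAC mulr_ge0 ?mul_conjC_ge0 // ltW.
apply/matrixP => i j; rewrite mxE.
have : \sum_i (Y *m diag_mx l *m Y^t*) i i == 0 by apply/eqP.
rewrite psumr_eq0 => [|k _]; last by rewrite mxE sumr_ge0.
move=> /allP/(_ i (mem_index_enum _))/=; rewrite mxE psumr_eq0 //.
move=> /allP/(_ j (mem_index_enum _))/=.
rewrite mul_mx_diag !mxE mulrAC mulf_eq0 (gt_eqF (lp j)) orbF.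
by rewrite mul_conjC_eq0 => /eqP.
Qed.

(** The eigenvalue l j of Q† Q is the squared norm of the j-th row of W Q†. *)
Lemma posdef_gram m n (Q : 'M[C]_(m, n)) :
  Q^t* *m Q \in unitmx -> posdef (Q^t* *m Q).
Proof.
set G := _ *m Q => Gu.
have Gn : G \is normalmx.
  by apply/normalmxP; rewrite /G trmx_mul map_mxM trmxCK.
have /orthomx_spectralP eG := Gn.
exists (spectralmx G), (spectral_diag G); split=> //.
  exact: spectral_unitarymx.
set W := spectralmx G in eG *; set l := spectral_diag G in eG *.
have Wu : W \is unitarymx by exact: spectral_unitarymx.
move=> j; have ljE : l 0 j = (W *m Q^t* *m (W *m Q^t*)^t*) j j.
  rewrite trmx_mul map_mxM trmxCK mulmxA -[_ *m _ *m Q]mulmxA -/G eG.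
  rewrite invmx_unitary // !mulmxA (unitarymxP Wu) mul1mx mulmxtVK //.
  by rewrite mxE eqxx.
rewrite lt_def; apply/andP; split.
  move: Gu; rewrite eG !unitmx_mul => /andP[/andP[_]].
  by rewrite unitmxE det_diag unitfE => /prodf_neq0 /(_ j isT).
by rewrite ljE mxE sumr_ge0 // => k _; rewrite !mxE mul_conjC_ge0.
Qed.

Lemma posdef1 n : posdef (1%:M : 'M[C]_n).
Proof.
exists 1%:M, (const_mx 1); split=> [|j|].
- by apply/unitarymxP; rewrite trmx1 map_mx1 mulmx1.
- by rewrite mxE ltr01.
- by rewrite diag_const_mx !mulmx1 invmx1.
Qed.

(** The positive square root is a function of the square, so it does not see
    which diagonalization the square came with. *)
Lemma posdef_sqr_inj n (G H : 'M[C]_n) :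
  posdef G -> posdef H -> G *m G = H *m H -> G = H.
Proof.
have sqr (K : 'M[C]_n) W l : W \is unitarymx -> K = invmx W *m diag_mx l *m W ->
    K *m K = invmx W *m diag_mx (map_mx (fun x => x ^+ 2) l) *m W.
  move=> Wu ->; rewrite !mulmxA mulmxK ?unitarymx_unit //.
  rewrite -[_ *m diag_mx l *m diag_mx l]mulmxA mulmx_diag.
  by congr (_ *m diag_mx _ *m _); apply/rowP => j; rewrite !mxE.
have sqrtK (l : 'rV[C]_n) : (forall j, 0 < l 0 j) ->
    map_mx sqrtC (map_mx (fun x => x ^+ 2) l) = l.
  by move=> lp; apply/rowP => j; rewrite !mxE sqrCK // ltW.
move=> [W [l [Wu lp eG]]] [W' [l' [Wu' lp' eH]]].
rewrite (sqr G W l) // (sqr H W' l') //.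
move/(diag_conj_calculus sqrtC (unitarymx_unit Wu) (unitarymx_unit Wu')).
by rewrite !sqrtK // -eG -eH.
Qed.

Lemma posdef_conj n (W G : 'M[C]_n) :
  W \is unitarymx -> posdef G -> posdef (invmx W *m G *m W).
Proof.
move=> Wu [V [l [Vu lp ->]]]; exists (V *m W), l; split=> //.
  exact: mul_unitarymx.
by rewrite !invmx_unitary ?mul_unitarymx // trmx_mul map_mxM !mulmxA.
Qed.

Lemma unitarymx_block m n (V : 'M[C]_m) (W : 'M[C]_n) :
  V \is unitarymx -> W \is unitarymx -> block_mx V 0 0 W \is unitarymx.
Proof.
move=> Vu Wu; apply/unitarymxP; rewrite tr_block_mx map_block_mx mulmx_block.
rewrite !trmx0 !(map_mx0 Num.Def.conjC) !(mulmx0, mul0mx, addr0, add0r).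
by rewrite (unitarymxP Vu) (unitarymxP Wu) -scalar_mx_block.
Qed.

Lemma unitarymx_tens m n (V : 'M[C]_m) (W : 'M[C]_n) :
  V \is unitarymx -> W \is unitarymx -> V *t W \is unitarymx.
Proof.
move=> Vu Wu; apply/unitarymxP; rewrite trmx_tens map_mxT tensmx_mul.
rewrite (unitarymxP Vu) (unitarymxP Wu).
apply/matrixP => i j; case: (mxtens_indexP i) => a b.
case: (mxtens_indexP j) => c d; rewrite tensmxE !mxE.
by rewrite (can_eq (@mxtens_indexK _ _)) xpair_eqE -natrM mulnb.
Qed.

Definition tens_row m n (l : 'rV[C]_m) (k : 'rV[C]_n) : 'rV[C]_(m * n) :=
  \row_j (l 0 (mxtens_unindex j).1 * k 0 (mxtens_unindex j).2).

Lemma diag_mx_tens m n (l : 'rV[C]_m) (k : 'rV[C]_n) :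
  diag_mx l *t diag_mx k = diag_mx (tens_row l k).
Proof.
apply/matrixP => i j; case: (mxtens_indexP i) => a b.
case: (mxtens_indexP j) => c d; rewrite tensmxE !mxE mxtens_indexK /=.
rewrite (can_eq (@mxtens_indexK _ _)) xpair_eqE.
by case: (a == c); case: (b == d); rewrite ?mulr1n ?mulr0n ?mulr0 ?mul0r.
Qed.

End FunctionalCalculus.

(** What matrix powers use of the function l^z on positive l. Keeping it
    abstract separates the algebra below from exponentials and logarithms. *)
Record power_laws (C : numClosedFieldType) (pow : C -> C -> C) : Prop :=
  PowerLaws {
    power_laws_D : forall l a b, 0 < l -> pow l (a + b) = pow l a * pow l b;
    power_laws_0 : forall l, 0 < l -> pow l 0 = 1;
    power_laws_1 : forall l, 0 < l -> pow l 1 = l;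
    power_laws_M : forall l m z, 0 < l -> 0 < m ->
      pow (l * m) z = pow l z * pow m z;
    power_laws_conj : forall l z, 0 < l -> (pow l z)^* = pow l (z^*) }.

Section MatrixPowers.
Variables (C : numClosedFieldType) (pow : C -> C -> C).
Hypothesis pow_laws : power_laws pow.

Let powD := power_laws_D pow_laws.
Let pow0 := power_laws_0 pow_laws.
Let pow1 := power_laws_1 pow_laws.
Let powM := power_laws_M pow_laws.
Let pow_conj := power_laws_conj pow_laws.

Definition mxpow n (F : 'M[C]_n) (z : C) : 'M[C]_n :=
  invmx (spectralmx F)
  *m diag_mx (map_mx (fun x => pow x z) (spectral_diag F))
  *m spectralmx F.

Lemma mxpowE n (W : 'M[C]_n) (l : 'rV[C]_n) z : W \is unitarymx ->
  mxpow (invmx W *m diag_mx l *m W) z =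
  invmx W *m diag_mx (map_mx (fun x => pow x z) l) *m W.
Proof.
move=> Wu; set G := _ *m W; have Gn : G \is normalmx.
  by apply/orthomx_spectral_subproof; exists (W, l).
apply: diag_conj_calculus.
- exact: spectral_unit.
- exact: unitarymx_unit.
- by rewrite -/G [RHS](orthomx_spectralP Gn).
Qed.

Lemma mxpowD n (G : 'M[C]_n) a b : posdef G ->
  mxpow G (a + b) = mxpow G a *m mxpow G b.
Proof.
move=> [W [l [Wu lp ->]]]; rewrite !mxpowE // !mulmxA mulmxK ?unitarymx_unit //.
rewrite -[_ *m diag_mx _ *m diag_mx _]mulmxA mulmx_diag.
by congr (_ *m diag_mx _ *m _); apply/rowP => j; rewrite !mxE powD.
Qed.

Lemma mxpow0 n (G : 'M[C]_n) : posdef G -> mxpow G 0 = 1%:M.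
Proof.
move=> [W [l [Wu lp ->]]]; rewrite mxpowE //.
have -> : map_mx (fun x => pow x 0) l = const_mx 1.
  by apply/rowP => j; rewrite !mxE pow0.
by rewrite diag_const_mx mulmx1 mulVmx ?unitarymx_unit.
Qed.

Lemma mxpow1 n (G : 'M[C]_n) : posdef G -> mxpow G 1 = G.
Proof.
move=> [W [l [Wu lp ->]]]; rewrite mxpowE //.
by congr (_ *m diag_mx _ *m _); apply/rowP => j; rewrite !mxE pow1.
Qed.

Lemma mxpowNK n (G : 'M[C]_n) z : posdef G ->
  mxpow G (- z) *m mxpow G z = 1%:M.
Proof. by move=> Gp; rewrite -mxpowD // addNr mxpow0. Qed.

Lemma mxpow_adj n (G : 'M[C]_n) z : posdef G ->
  (mxpow G z)^t* = mxpow G (z^*).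
Proof.
move=> [W [l [Wu lp ->]]]; rewrite !mxpowE // invmx_unitary //.
rewrite !trmx_mul !map_mxM trmxCK mulmxA tr_diag_mx map_diag_mx.
by congr (_ *m diag_mx _ *m _); apply/rowP => j; rewrite !mxE; apply: pow_conj.
Qed.

Lemma mxpow_conj n (W G : 'M[C]_n) z : W \is unitarymx -> posdef G ->
  mxpow (invmx W *m G *m W) z = invmx W *m mxpow G z *m W.
Proof.
move=> Wu [V [l [Vu lp ->]]]; have VWu := mul_unitarymx Vu Wu.
have iVW : invmx W *m invmx V = invmx (V *m W).
  by rewrite !invmx_unitary // trmx_mul map_mxM.
rewrite mxpowE // !mulmxA iVW -[in RHS]mulmxA -!(mulmxA _ V W).
by rewrite mxpowE // !mulmxA.
Qed.

Lemma block_calculus m n (V : 'M[C]_m) (l : 'rV[C]_m) (W : 'M[C]_n) (k : 'rV[C]_n) :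
    V \is unitarymx -> W \is unitarymx ->
  block_mx (invmx V *m diag_mx l *m V) 0 0 (invmx W *m diag_mx k *m W) =
  invmx (block_mx V 0 0 W) *m diag_mx (row_mx l k) *m block_mx V 0 0 W.
Proof.
move=> Vu Wu; rewrite (invmx_unitary (unitarymx_block Vu Wu)) !invmx_unitary //.
rewrite tr_block_mx map_block_mx !trmx0 !(map_mx0 Num.Def.conjC) diag_mx_row.
by rewrite !mulmx_block !(mulmx0, mul0mx, addr0, add0r).
Qed.

Lemma posdef_block m n (G : 'M[C]_m) (H : 'M[C]_n) :
  posdef G -> posdef H -> posdef (block_mx G 0 0 H).
Proof.
move=> [V [l [Vu lp ->]]] [W [k [Wu kp ->]]].
exists (block_mx V 0 0 W), (row_mx l k); split.
- exact: unitarymx_block.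
- by move=> j; rewrite mxE; case: splitP.
- exact: block_calculus.
Qed.

Lemma mxpow_block m n (G : 'M[C]_m) (H : 'M[C]_n) z : posdef G -> posdef H ->
  mxpow (block_mx G 0 0 H) z = block_mx (mxpow G z) 0 0 (mxpow H z).
Proof.
move=> [V [l [Vu lp ->]]] [W [k [Wu kp ->]]].
rewrite block_calculus // !mxpowE ?unitarymx_block // map_row_mx.
by rewrite -block_calculus.
Qed.

Lemma tens_calculus m n (V : 'M[C]_m) (l : 'rV[C]_m) (W : 'M[C]_n) (k : 'rV[C]_n) :
    V \is unitarymx -> W \is unitarymx ->
  (invmx V *m diag_mx l *m V) *t (invmx W *m diag_mx k *m W) =
  invmx (V *t W) *m diag_mx (tens_row l k) *m (V *t W).
Proof.
move=> Vu Wu; rewrite (invmx_unitary (unitarymx_tens Vu Wu)) !invmx_unitary //.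
by rewrite trmx_tens map_mxT -diag_mx_tens !tensmx_mul.
Qed.

Lemma posdef_tens m n (G : 'M[C]_m) (H : 'M[C]_n) :
  posdef G -> posdef H -> posdef (G *t H).
Proof.
move=> [V [l [Vu lp ->]]] [W [k [Wu kp ->]]].
exists (V *t W), (tens_row l k); split.
- exact: unitarymx_tens.
- by move=> j; rewrite mxE mulr_gt0.
- exact: tens_calculus.
Qed.

Lemma mxpow_tens m n (G : 'M[C]_m) (H : 'M[C]_n) z : posdef G -> posdef H ->
  mxpow (G *t H) z = mxpow G z *t mxpow H z.
Proof.
move=> [V [l [Vu lp ->]]] [W [k [Wu kp ->]]].
rewrite tens_calculus // !mxpowE ?unitarymx_tens // tens_calculus //.
congr (_ *m diag_mx _ *m _); apply/rowP => j; rewrite !mxE.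
exact: powM.
Qed.

End MatrixPowers.

(** * Complex powers of positive numbers *)
Section ComplexPowers.
Variable R : realType.
Local Notation C := (R[i]).
Local Open Scope complex_scope.

Lemma cexpD (a b : C) : cexp (a + b) = cexp a * cexp b.
Proof.
case: a b => [x y] [x' y']; apply/eqP; rewrite eq_complex /= expRD cosD sinD.
by apply/andP; split; apply/eqP; ring.
Qed.

Lemma cexp0 : cexp (0 : C) = 1.
Proof. by rewrite /cexp /= expR0 cos0 sin0 mulr1 mulr0. Qed.

Lemma cexp_conj (a : C) : (cexp a)^* = cexp (a^*).
Proof.
case: a => x y; change (conjc (cexp (x +i* y)) = cexp (conjc (x +i* y))).
by rewrite /cexp /= cosN sinN mulrN.
Qed.

Lemma posC (l : C) : 0 < l -> l = (complex.Re l)%:C /\ 0 < complex.Re l.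
Proof. by case: l => x y; rewrite ltcE /= => /andP[/eqP -> ?]. Qed.

Lemma cpowD (l a b : C) : cpow l (a + b) = cpow l a * cpow l b.
Proof. by rewrite /cpow mulrDl cexpD. Qed.

Lemma cpow0 (l : C) : cpow l 0 = 1.
Proof. by rewrite /cpow mul0r cexp0. Qed.

Lemma cpow1 (l : C) : 0 < l -> cpow l 1 = l.
Proof.
move/posC => [e l0]; rewrite [RHS]e /cpow mul1r /cexp /= cos0 sin0 mulr1 mulr0.
by rewrite lnK.
Qed.

Lemma cpowMl (l m z : C) : 0 < l -> 0 < m ->
  cpow (l * m) z = cpow l z * cpow m z.
Proof.
move=> /posC[el l0] /posC[em m0]; rewrite /cpow -cexpD -mulrDr; congr (cexp (_ * _)).
by rewrite {1}el {1}em -rmorphM /= lnM // rmorphD.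
Qed.

Lemma cpow_conj (l z : C) : (cpow l z)^* = cpow l (z^*).
Proof.
rewrite /cpow cexp_conj rmorphM /=; congr (cexp (_ * _)).
by change (conjc (ln (complex.Re l))%:C = (ln (complex.Re l))%:C); rewrite /= oppr0.
Qed.

Lemma cpow_laws : power_laws (@cpow R).
Proof.
split=> *; [exact: cpowD | exact: cpow0 | exact: cpow1 | exact: cpowMl|].
exact: cpow_conj.
Qed.

End ComplexPowers.

(** * Matrices over a Hopf algebra and linear functionals *)
HB.instance Definition _ (K : fieldType) (A : hopfAlgType K) :=
  GRing.isLinear.Build K A (tensor A A) _ (@comul K A) comul_linear.
HB.instance Definition _ (K : fieldType) (A : hopfAlgType K) :=
  GRing.isMonoidMorphism.Build A (tensor A A) (@comul K A) comul_monoid.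
HB.instance Definition _ (K : fieldType) (A : hopfAlgType K) :=
  GRing.isLinear.Build K A K _ (@counit K A) counit_linear.
HB.instance Definition _ (K : fieldType) (A : hopfAlgType K) :=
  GRing.isLinear.Build K A A _ (@antipode K A) antipode_linear.

Section TensorSums.
Variables (K : comNzRingType) (V W : lmodType K) (U : nmodType).
Variable b : V -> W -> U.

Lemma tlift_sum : (forall w, b 0 w = 0) ->
  (forall v v' w, b (v + v') w = b v w + b v' w) ->
  (forall v w w', b v (w + w') = b v w + b v w') ->
  (forall k v w, b (k *: v) w = b v (k *: w)) ->
  forall I (r : seq I) (x : I -> V) (y : I -> W),
  tlift b (\sum_(i <- r) x i \ox y i) = \sum_(i <- r) b (x i) (y i).
Proof.
move=> b0 bDl bDr bZ I r x y.
rewrite -(big_map (fun i => (x i, y i)) xpredT (fun p => p.1 \ox p.2)) -tpiE.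
by rewrite tlift_pi // big_map.
Qed.

End TensorSums.

Section ScalarMatrices.
Variables (K : fieldType) (A : hopfAlgType K).
Local Notation sc := (scalmx A).

Lemma scalmxM m n p (X : 'M[K]_(m, n)) (Y : 'M[K]_(n, p)) :
  sc (X *m Y) = sc X *m sc Y.
Proof. exact: map_mxM. Qed.

Lemma scalmx1 n : sc (1%:M : 'M[K]_n) = 1%:M.
Proof. exact: map_mx1. Qed.

Lemma scalmx0 m n : sc (0 : 'M[K]_(m, n)) = 0.
Proof. exact: map_mx0. Qed.

Lemma scalmxB m n (X Y : 'M[K]_(m, n)) : sc (X - Y) = sc X - sc Y.
Proof. exact: map_mxB. Qed.

Lemma scalmxVK n (X : 'M[K]_n) : X \in unitmx -> sc (invmx X) *m sc X = 1%:M.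
Proof. by move=> Xu; rewrite -scalmxM mulVmx // scalmx1. Qed.

Lemma scalmxKV n (X : 'M[K]_n) : X \in unitmx -> sc X *m sc (invmx X) = 1%:M.
Proof. by move=> Xu; rewrite -scalmxM mulmxV // scalmx1. Qed.

Lemma sc_mulE m n p (X : 'M[K]_(m, n)) (Y : 'M[A]_(n, p)) i j :
  (sc X *m Y) i j = \sum_k X i k *: Y k j.
Proof. by rewrite mxE; apply: eq_bigr => k _; rewrite mxE mulr_algl. Qed.

Lemma mul_scE m n p (Y : 'M[A]_(m, n)) (X : 'M[K]_(n, p)) i j :
  (Y *m sc X) i j = \sum_k X k j *: Y i k.
Proof. by rewrite mxE; apply: eq_bigr => k _; rewrite mxE mulr_algr. Qed.

Lemma scalmx_scalarC m n (c : K) (Y : 'M[A]_(m, n)) :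
  sc c%:M *m Y = Y *m sc c%:M.
Proof.
apply/matrixP => i j; rewrite sc_mulE mul_scE (bigD1 i) //= big1 => [|k ki].
  rewrite [RHS](bigD1 j) //= big1 => [|k kj]; first by rewrite !mxE !eqxx.
  by rewrite mxE (negPf kj) scale0r.
by rewrite mxE eq_sym (negPf ki) scale0r.
Qed.

Lemma tr_sc_mul m n p (X : 'M[K]_(m, n)) (Y : 'M[A]_(n, p)) :
  (sc X *m Y)^T = Y^T *m sc X^T.
Proof.
apply/matrixP => i j; rewrite mxE sc_mulE mul_scE.
by apply: eq_bigr => k _; rewrite !mxE.
Qed.

Lemma tr_mul_sc m n p (Y : 'M[A]_(m, n)) (X : 'M[K]_(n, p)) :
  (Y *m sc X)^T = sc X^T *m Y^T.
Proof.
apply/matrixP => i j; rewrite mxE sc_mulE mul_scE.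
by apply: eq_bigr => k _; rewrite !mxE.
Qed.

Lemma map_sc_mul (s : {linear A -> A}) m n p
    (X : 'M[K]_(m, n)) (Y : 'M[A]_(n, p)) :
  map_mx s (sc X *m Y) = sc X *m map_mx s Y.
Proof.
apply/matrixP => i j; rewrite mxE !sc_mulE linear_sum.
by apply: eq_bigr => k _; rewrite linearZ !mxE.
Qed.

Lemma map_mul_sc (s : {linear A -> A}) m n p
    (Y : 'M[A]_(m, n)) (X : 'M[K]_(n, p)) :
  map_mx s (Y *m sc X) = map_mx s Y *m sc X.
Proof.
apply/matrixP => i j; rewrite mxE !mul_scE linear_sum.
by apply: eq_bigr => k _; rewrite linearZ !mxE.
Qed.

Lemma scalar_sc_mul (phi : {scalar A}) m n p
    (X : 'M[K]_(m, n)) (Y : 'M[A]_(n, p)) :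
  map_mx phi (sc X *m Y) = X *m map_mx phi Y.
Proof.
apply/matrixP => i j; rewrite mxE sc_mulE linear_sum mxE.
by apply: eq_bigr => k _; rewrite linearZ !mxE.
Qed.

Lemma scalar_mul_sc (phi : {scalar A}) m n p
    (Y : 'M[A]_(m, n)) (X : 'M[K]_(n, p)) :
  map_mx phi (Y *m sc X) = map_mx phi Y *m X.
Proof.
apply/matrixP => i j; rewrite mxE mul_scE linear_sum mxE.
by apply: eq_bigr => k _; rewrite linearZ !mxE mulrC.
Qed.

End ScalarMatrices.

Section Functionals.
Variables (K : fieldType) (A : hopfAlgType K).

Definition mkscalar (phi : A -> K) (h : scalar phi) : {scalar A} :=
  HB.pack phi (GRing.isLinear.Build K A K *%R phi h).

Lemma conv_scalar (phi chi : {scalar A}) :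
  scalar (fun a => tlift (fun x y => phi x * chi y : K^o) (comul a)).
Proof.
have lin : linear (tlift (fun x y => phi x * chi y : K^o)).
  apply: tlift_linear => [w|v] c x y; first by rewrite linearP mulrDl -mulrA.
  by rewrite linearP mulrDr mulrCA.
by move=> k a b; rewrite linearP; apply: lin.
Qed.

(** The product of the algebra dual to the coalgebra A. *)
Definition conv phi chi : {scalar A} := mkscalar (conv_scalar phi chi).

Section OneCorep.
Variables (n : nat) (t : 'M[A]_n) (t_corep : corep t).

Lemma conv_corep phi chi :
  map_mx (conv phi chi) t = map_mx phi t *m map_mx chi t.
Proof.
apply/matrixP => i j; rewrite !mxE /= (proj1 t_corep) tlift_sum.
- by apply: eq_bigr => k _; rewrite !mxE.
- by move=> w; rewrite linear0 mul0r.
- by move=> v v' w; rewrite linearD mulrDl.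
- by move=> v w w'; rewrite linearD mulrDr.
- by move=> k v w; rewrite !linearZ /= mulrCA mulrA.
Qed.

Lemma corep_mulV : t *m map_mx antipode t = 1%:M.
Proof.
apply/matrixP => i j; rewrite !mxE.
have := antipoder (t i j); rewrite (proj1 t_corep) (proj2 t_corep) tlift_sum.
- move=> e; rewrite scaler_nat in e; rewrite -e.
  by apply: eq_bigr => k _; rewrite mxE.
- by move=> w; rewrite mul0r.
- by move=> v v' w; rewrite mulrDl.
- by move=> v w w'; rewrite linearD mulrDr.
- by move=> k v w; rewrite linearZ /= -scalerAl scalerAr.
Qed.

Lemma corep_mulVl : map_mx antipode t *m t = 1%:M.
Proof.
apply/matrixP => i j; rewrite !mxE.
have := antipodel (t i j); rewrite (proj1 t_corep) (proj2 t_corep) tlift_sum.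
- move=> e; rewrite scaler_nat in e; rewrite -e.
  by apply: eq_bigr => k _; rewrite mxE.
- by move=> w; rewrite linear0 mul0r.
- by move=> v v' w; rewrite linearD mulrDl.
- by move=> v w w'; rewrite mulrDr.
- by move=> k v w; rewrite linearZ /= -scalerAl scalerAr.
Qed.

Lemma lact_corep (f : {scalar A}) :
  map_mx (lact f) t = t *m scalmx A (map_mx f t).
Proof.
apply/matrixP => i j; rewrite mul_scE mxE /lact (proj1 t_corep) tlift_sum.
- by apply: eq_bigr => k _; rewrite mxE.
- by move=> w; rewrite scaler0.
- by move=> v v' w; rewrite scalerDr.
- by move=> v w w'; rewrite linearD scalerDl.
- by move=> k v w; rewrite scalarZ scalerA mulrC.
Qed.

Lemma ract_corep (f : {scalar A}) :
  map_mx (fun a => ract a f) t = scalmx A (map_mx f t) *m t.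
Proof.
apply/matrixP => i j; rewrite sc_mulE mxE /ract (proj1 t_corep) tlift_sum.
- by apply: eq_bigr => k _; rewrite mxE.
- by move=> w; rewrite linear0 scale0r.
- by move=> v v' w; rewrite linearD scalerDl.
- by move=> v w w'; rewrite scalerDr.
- by move=> k v w; rewrite scalarZ scalerA mulrC.
Qed.

End OneCorep.

Lemma lact_linear (f : {scalar A}) : linear (lact f : A -> A).
Proof.
move=> k a b; rewrite /lact linearP; apply: tlift_linear => [w|v] c x y.
  by rewrite scalerDr !scalerA mulrC.
by rewrite linearP scalerDl scalerA.
Qed.

Lemma ract_linear (f : {scalar A}) : linear (fun a : A => ract a f).
Proof.
move=> k a b; rewrite /ract linearP; apply: tlift_linear => [w|v] c x y.
  by rewrite linearP scalerDl scalerA.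
by rewrite scalerDr !scalerA mulrC.
Qed.

Lemma ract_lact_corep n (t : 'M[A]_n) (f g : {scalar A}) : corep t ->
  map_mx (fun a => ract (lact f a) g) t =
  scalmx A (map_mx g t) *m t *m scalmx A (map_mx f t).
Proof.
move=> tc; apply/matrixP => i j; rewrite mul_scE mxE.
have /matrixP/(_ i j) := lact_corep tc f; rewrite mxE mul_scE => ->.
have rlin := ract_linear g.
pose r : {linear A -> A} := HB.pack (fun a : A => ract a g)
  (GRing.isLinear.Build K A A _ (fun a : A => ract a g) rlin).
rewrite -[LHS]/(r _) linear_sum; apply: eq_bigr => k _; rewrite linearZ /=.
by have /matrixP/(_ i k) := ract_corep tc g; rewrite mxE => ->.
Qed.

(** By Zorn's lemma there is a maximal subspace M avoiding a given a <> 0. It is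
    a complement of the line of a, and the coordinate along a is a functional
    that does not vanish at a. *)
Lemma scalar_separates (a : A) : (forall phi : {scalar A}, phi a = 0) -> a = 0.
Proof.
move=> phi0; apply: contrapT => a0.
pose subsp (S : A -> Prop) :=
  [/\ S 0, forall k x y, S x -> S y -> S (k *: x + y) & ~ S a].
pose T := {S : A -> Prop | subsp S}.
pose le (S S' : T) := `[< forall x, sval S x -> sval S' x >].
have sub0 : subsp (fun x => x = 0).
  by split=> // k x y -> ->; rewrite scaler0 addr0.
have [||F tot|[M [M0 MP Ma]] Mmax] := @ZL_preorder T (exist _ _ sub0) le.
- by move=> S; apply/asboolP.
- by move=> S' S S'' /asboolP h /asboolP h'; apply/asboolP => x /h /h'.
- have [[S0 FS0]|none] := pselect (exists S, F S); last first.
    exists (exist _ _ sub0) => S FS; case: none; by exists S.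
  have subU : subsp (fun x => exists2 S : T, F S & sval S x).
    split.
    - by exists S0 => //; case: (svalP S0).
    - move=> k x y [S FS Sx] [S' FS' S'y].
      have [/asboolP SS'|/asboolP S'S] := tot _ _ FS FS'.
        by exists S' => //; case: (svalP S') => _ + _; apply=> //; apply: SS'.
      by exists S => //; case: (svalP S) => _ + _; apply=> //; apply: S'S.
    - by move=> [S FS]; case: (svalP S).
  exists (exist _ _ subU) => S FS; apply/asboolP => x Sx /=.
  by exists S.
(* By maximality every vector is a multiple of a modulo M. *)
have coef x : exists k, M (x - k *: a).
  apply: contrapT => nk.
  have subX : subsp (fun y => exists2 k, M (y - k *: x) & True).
    split.
    - by exists 0 => //; rewrite scale0r subr0.
    - move=> k y z [c Mc _] [c' Mc' _]; exists (k * c + c') => //.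
      have -> : k *: y + z - (k * c + c') *: x =
          k *: (y - c *: x) + (z - c' *: x).
        by rewrite scalerBr scalerDl opprD scalerA addrACA.
      exact: (MP).
    - move=> [k Mk _]; have [k0|k0] := eqVneq k 0.
        by apply: (Ma); move: Mk; rewrite k0 scale0r subr0.
      apply: nk; exists k^-1.
      have := MP (- k^-1) _ _ Mk M0; rewrite addr0 scalerBr scalerA mulNr.
      by rewrite mulVf // scaleN1r scaleNr opprK addrC.
  have /asboolP le' : le (exist _ _ subX) (exist _ M (And3 M0 MP Ma)).
    apply: Mmax; apply/asboolP => y /= My; exists 0 => //.
    by rewrite scale0r subr0.
  apply: nk; exists 0; rewrite scale0r subr0; apply: le' => /=.
  by exists 1 => //; rewrite scale1r subrr.
have coef_uniq x k k' : M (x - k *: a) -> M (x - k' *: a) -> k = k'.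
  move=> Mk Mk'; apply: contrapT => kk'; apply: (Ma).
  have d0 : k' - k != 0 by rewrite subr_eq0 eq_sym; apply/eqP.
  have := MP (-1) _ _ Mk' Mk; rewrite scaleN1r opprB addrA.
  rewrite subrK => Md; have := MP (k' - k)^-1 _ _ Md M0.
  by rewrite addr0 -scalerBl scalerA mulVf // scale1r.
pose phi x := projT1 (cid (coef x)).
have phiP x : M (x - phi x *: a) by rewrite /phi; case: cid.
have phi_scalar : scalar phi.
  move=> k x y; apply: (coef_uniq (k *: x + y)) => //.
  have -> : k *: x + y - (k * phi x + phi y) *: a =
      k *: (x - phi x *: a) + (y - phi y *: a).
    by rewrite scalerBr scalerDl opprD scalerA addrACA.
  exact: (MP).
have := phi0 (mkscalar phi_scalar) => /= e.
by have := phiP a; rewrite e scale0r subr0.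
Qed.

End Functionals.

(** * Corepresentations and involutions *)
Lemma sum_mxtens (V : nmodType) m n (F : 'I_(m * n) -> V) :
  \sum_k F k = \sum_i \sum_j F (mxtens_index (i, j)).
Proof.
rewrite pair_big /= (reindex (@mxtens_index m n)) /=; last first.
  by exists (@mxtens_unindex m n) => k _; rewrite (mxtens_indexK, mxtens_unindexK).
by apply: eq_bigr => -[].
Qed.

Section TensorLegs.
Variables (K : fieldType) (A : hopfAlgType K).

(** The embeddings a |-> a (x) 1 and a |-> 1 (x) a are algebra morphisms; they
    turn the comultiplication rule of a corepresentation into a product of
    matrices over A (x) A, see corepE. *)
Definition leg1 (a : A) : tensor A A := a \ox 1.
Definition leg2 (a : A) : tensor A A := 1 \ox a.

Lemma leg1_linear : linear leg1.
Proof. by move=> k a b; rewrite /leg1 tpureDl tpureZl. Qed.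
Lemma leg2_linear : linear leg2.
Proof. by move=> k a b; rewrite /leg2 tpureDr tpureZr. Qed.
Lemma leg1_monoid : monoid_morphism leg1.
Proof. by split=> // a b; rewrite /leg1 [RHS]tmul_pure mulr1. Qed.
Lemma leg2_monoid : monoid_morphism leg2.
Proof. by split=> // a b; rewrite /leg2 [RHS]tmul_pure mulr1. Qed.

HB.instance Definition _ := GRing.isLinear.Build K A (tensor A A) _ leg1 leg1_linear.
HB.instance Definition _ := GRing.isLinear.Build K A (tensor A A) _ leg2 leg2_linear.
HB.instance Definition _ :=
  GRing.isMonoidMorphism.Build A (tensor A A) leg1 leg1_monoid.
HB.instance Definition _ :=
  GRing.isMonoidMorphism.Build A (tensor A A) leg2 leg2_monoid.

Lemma leg12 a b : leg1 a * leg2 b = a \ox b.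
Proof. by rewrite [LHS]tmul_pure mulr1 mul1r. Qed.

Lemma corepE n (t : 'M[A]_n) : corep t <->
  map_mx comul t = map_mx leg1 t *m map_mx leg2 t /\ map_mx counit t = 1%:M.
Proof.
split=> [[tD te]|[/matrixP tD /matrixP te]].
  split; apply/matrixP => i j; rewrite !mxE ?te // tD.
  by apply: eq_bigr => k _; rewrite !mxE leg12.
split=> i j; [have := tD i j | have := te i j]; rewrite !mxE // => ->.
by apply: eq_bigr => k _; rewrite !mxE leg12.
Qed.

Lemma comul_scalmx m n (X : 'M[K]_(m, n)) :
  map_mx comul (scalmx A X) = map_mx leg1 (scalmx A X).
Proof. by apply/matrixP => i j; rewrite !mxE !linearZ rmorph1. Qed.

Lemma legs_scalmx m n (X : 'M[K]_(m, n)) :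
  map_mx leg1 (scalmx A X) = map_mx leg2 (scalmx A X).
Proof. by apply/matrixP => i j; rewrite !mxE !linearZ. Qed.

Lemma counit_scalmx m n (X : 'M[K]_(m, n)) :
  map_mx counit (scalmx A X) = X.
Proof.
by apply/matrixP => i j; rewrite !mxE linearZ /= (fst counit_monoid) mulr1.
Qed.

Lemma corep_conj m n (V : 'M[K]_(m, n)) (W : 'M[K]_(n, m)) (t : 'M[A]_n) :
  V *m W = 1%:M -> W *m V = 1%:M -> corep t ->
  corep (scalmx A V *m t *m scalmx A W).
Proof.
move=> VW WV /corepE[tD te]; apply/corepE; split.
  have key : map_mx leg2 (scalmx A W) *m map_mx leg2 (scalmx A V) = 1%:M.
    by rewrite -map_mxM -scalmxM WV scalmx1 map_mx1.
  rewrite !map_mxM !comul_scalmx tD (legs_scalmx W) !mulmxA.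
  by rewrite -[_ *m map_mx leg2 (scalmx A W) *m _]mulmxA key mulmx1.
by rewrite scalar_mul_sc scalar_sc_mul te mulmx1 VW.
Qed.

Lemma corep_block m n (t : 'M[A]_m) (u : 'M[A]_n) :
  corep t -> corep u -> corep (block_mx t 0 0 u).
Proof.
move=> /corepE[tD te] /corepE[uD ue]; apply/corepE; split; rewrite !map_block_mx.
  by rewrite mulmx_block !map_mx0 !(mul0mx, mulmx0, addr0, add0r) tD uD.
by rewrite !map_mx0 te ue -scalar_mx_block.
Qed.

Lemma corep_block_inv m n (t : 'M[A]_m) (u : 'M[A]_n) :
  corep (block_mx t 0 0 u) -> corep t /\ corep u.
Proof.
move=> /corepE; rewrite !map_block_mx mulmx_block !map_mx0.
rewrite !(mul0mx, mulmx0, addr0, add0r) => -[/eq_block_mx[tD _ _ uD]].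
rewrite scalar_mx_block => /eq_block_mx[te _ _ ue].
by split; apply/corepE.
Qed.

Lemma corep_tens m n (t : 'M[A]_m) (u : 'M[A]_n) :
  corep t -> corep u -> corep (t *t u).
Proof.
move=> [tD te] [uD ue]; split=> i j; case: (mxtens_indexP i) => a b;
  case: (mxtens_indexP j) => c d; rewrite tensmxE; last first.
  rewrite (snd counit_monoid) te ue (can_eq (@mxtens_indexK _ _)) xpair_eqE.
  by rewrite -natrM mulnb.
rewrite rmorphM /= tD uD mulr_suml sum_mxtens; apply: eq_bigr => k _.
rewrite mulr_sumr; apply: eq_bigr => l _.
by rewrite !tensmxE [LHS]tmul_pure.
Qed.

Lemma corep_one : corep (1%:M : 'M[A]_1).
Proof.
apply/corepE; split; first by rewrite !map_mx1 mulmx1.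
by rewrite -[1%:M](scalmx1 A) counit_scalmx.
Qed.

Lemma corep_nil (t : 'M[A]_0) : corep t.
Proof. by split=> -[]. Qed.

End TensorLegs.

Section Antilinear.
Variables (C : numClosedFieldType) (A : hopfAlgType C) (b : A -> A).
Hypothesis bP : forall (k : C) x y, b (k *: x + y) = k^* *: b x + b y.
Local Notation sc := (scalmx A).

Lemma antilinearD : {morph b : x y / x + y}.
Proof. by move=> x y; rewrite -[x in LHS]scale1r bP conjC1 scale1r. Qed.

Lemma antilinear0 : b 0 = 0.
Proof. by apply: (addrI (b 0)); rewrite -antilinearD !addr0. Qed.

Lemma antilinearZ k a : b (k *: a) = k^* *: b a.
Proof. by rewrite -[_ *: a]addr0 bP antilinear0 addr0. Qed.

Lemma antilinear_sum I (r : seq I) (P : pred I) (F : I -> A) :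
  b (\sum_(i <- r | P i) F i) = \sum_(i <- r | P i) b (F i).
Proof. exact: (big_morph b antilinearD antilinear0). Qed.

Lemma antilinear_sc_mul m n p (X : 'M[C]_(m, n)) (Y : 'M[A]_(n, p)) :
  map_mx b (sc X *m Y) = sc (map_mx Num.conj X) *m map_mx b Y.
Proof.
apply/matrixP => i j; rewrite mxE !sc_mulE antilinear_sum.
by apply: eq_bigr => k _; rewrite antilinearZ !mxE.
Qed.

Lemma antilinear_mul_sc m n p (X : 'M[C]_(n, p)) (Y : 'M[A]_(m, n)) :
  map_mx b (Y *m sc X) = map_mx b Y *m sc (map_mx Num.conj X).
Proof.
apply/matrixP => i j; rewrite mxE !mul_scE antilinear_sum.
by apply: eq_bigr => k _; rewrite antilinearZ !mxE.
Qed.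

Lemma tmap_antilinear_sum I (r : seq I) (x y : I -> A) :
  tmap b b (\sum_(i <- r) x i \ox y i) = \sum_(i <- r) b (x i) \ox b (y i).
Proof.
apply: tlift_sum.
- by move=> w; rewrite antilinear0 tpure0l.
- by move=> v v' w; rewrite antilinearD tpureDl.
- by move=> v w w'; rewrite antilinearD tpureDr.
- by move=> k v w; rewrite !antilinearZ tpureZ.
Qed.

Lemma tmap_antilinear k (x y : tensor A A) :
  tmap b b (k *: x + y) = k^* *: tmap b b x + tmap b b y.
Proof.
rewrite (tensorE x) (tensorE y) scaler_sumr.
under eq_bigr => p _ do rewrite -tpureZl.
rewrite -[\sum_(i <- repr x) _](big_map (fun p => (k *: p.1, p.2)) xpredT
  (fun p => p.1 \ox p.2)) -big_cat.
rewrite !tmap_antilinear_sum big_cat big_map; congr (_ + _).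
by rewrite scaler_sumr; apply: eq_bigr => p _; rewrite antilinearZ tpureZl.
Qed.

End Antilinear.

Section Star.
Variables (C : numClosedFieldType) (A : hopfAlgType C) (st : A -> A).
Hypothesis st_star : is_hopf_star st.
Local Notation sc := (scalmx A).
Local Notation S := (map_mx (@antipode C A)).

Let st_inv : is_involution st. Proof. by case: st_star. Qed.

Lemma starP (k : C) a b : st (k *: a + b) = k^* *: st a + st b.
Proof. by case: st_inv. Qed.

Lemma starK : involutive st. Proof. by case: st_inv. Qed.
Lemma starD : {morph st : x y / x + y}.
Proof. exact: (antilinearD starP). Qed.
Lemma star0 : st 0 = 0. Proof. exact: (antilinear0 starP). Qed.
Lemma starZ k a : st (k *: a) = k^* *: st a.
Proof. exact: (antilinearZ starP). Qed.
Lemma starM a b : st (a * b) = st b * st a. Proof. by case: st_inv. Qed.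
Lemma star1 : st 1 = 1.
Proof. by have := starM (st 1) 1; rewrite mulr1 starK mulr1. Qed.
Lemma star_sum I (r : seq I) (P : pred I) (F : I -> A) :
  st (\sum_(i <- r | P i) F i) = \sum_(i <- r | P i) st (F i).
Proof. exact: (antilinear_sum starP). Qed.

Definition adj m n (X : 'M[A]_(m, n)) : 'M[A]_(n, m) := (map_mx st X)^T.

Lemma adjM m n p (X : 'M[A]_(m, n)) (Y : 'M[A]_(n, p)) :
  adj (X *m Y) = adj Y *m adj X.
Proof.
apply/matrixP => i j; rewrite !mxE star_sum; apply: eq_bigr => k _.
by rewrite !mxE starM.
Qed.

Lemma adj_scalmx m n (X : 'M[C]_(m, n)) : adj (sc X) = sc (X^t*).
Proof. by apply/matrixP => i j; rewrite !mxE starZ star1. Qed.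

Lemma unitaryE n (t : 'M[A]_n) :
  unitary_corep st t <-> corep t /\ S t = adj t.
Proof.
split=> -[tc e]; split=> //; first by apply/matrixP => i j; rewrite !mxE e.
by move=> i j; move/matrixP/(_ i j): e; rewrite !mxE.
Qed.

(** The antipode of a corepresentation is its inverse matrix, and a left
    inverse of an invertible matrix is the inverse. *)
Lemma unitaryI n (t : 'M[A]_n) : corep t -> adj t *m t = 1%:M ->
  unitary_corep st t.
Proof.
move=> tc e; apply/unitaryE; split=> //.
by rewrite -[S t]mul1mx -e -mulmxA corep_mulV // mulmx1.
Qed.

Lemma unitary_adjl n (t : 'M[A]_n) : unitary_corep st t -> adj t *m t = 1%:M.
Proof. by move/unitaryE => [tc <-]; rewrite corep_mulVl. Qed.

Lemma unitary_adjr n (t : 'M[A]_n) : unitary_corep st t -> t *m adj t = 1%:M.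
Proof. by move/unitaryE => [tc <-]; rewrite corep_mulV. Qed.

Lemma unitary_conj m n (W : 'M[C]_(m, n)) (t : 'M[A]_n) :
  W *m W^t* = 1%:M -> W^t* *m W = 1%:M -> unitary_corep st t ->
  unitary_corep st (sc W *m t *m sc (W^t*)).
Proof.
move=> WW WW' tu; apply: unitaryI; first by apply: corep_conj => //; case: tu.
rewrite !adjM !adj_scalmx trmxCK !mulmxA -[_ *m _ *m sc W]mulmxA -scalmxM WW'.
rewrite scalmx1 mulmx1 -[_ *m _ *m t]mulmxA unitary_adjl // mulmx1.
by rewrite -scalmxM WW scalmx1.
Qed.

Lemma unitary_block m n (t : 'M[A]_m) (u : 'M[A]_n) :
  unitary_corep st t -> unitary_corep st u ->
  unitary_corep st (block_mx t 0 0 u).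
Proof.
move=> tu uu; apply: unitaryI; first by apply: corep_block; [case: tu|case: uu].
have st00 p q : map_mx st (0 : 'M_(p, q)) = 0.
  by apply/matrixP => i j; rewrite !mxE star0.
rewrite /adj map_block_mx tr_block_mx !st00 !trmx0 mulmx_block.
rewrite !(mul0mx, mulmx0, addr0, add0r) -!/(adj _) !unitary_adjl //.
by rewrite -scalar_mx_block.
Qed.

(** The antipode takes the lower left block to the adjoint of the upper right
    one, so the complement of an invariant subspace is invariant. *)
Lemma unitary_block_inv m n (t : 'M[A]_m) (x : 'M[A]_(n, m)) (u : 'M[A]_n) :
  unitary_corep st (block_mx t 0 x u) ->
  [/\ x = 0, unitary_corep st t & unitary_corep st u].
Proof.
move=> tu; case/unitaryE: (tu) => _.
rewrite /adj !map_block_mx tr_block_mx => /eq_block_mx[St Sx _ Su].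
have x0 : x = 0.
  apply/matrixP => i j; move/matrixP/(_ j i): Sx.
  by rewrite !mxE linear0 => /esym/(congr1 st); rewrite starK star0.
case: tu; rewrite x0 => /corep_block_inv[tc uc] _.
by split=> //; apply/unitaryE; split.
Qed.

Lemma unitary_tens m n (t : 'M[A]_m) (u : 'M[A]_n) :
  unitary_corep st t -> unitary_corep st u -> unitary_corep st (t *t u).
Proof.
move=> tu uu; apply: unitaryI; first by apply: corep_tens; [case: tu|case: uu].
apply/matrixP => i j; case: (mxtens_indexP i) => a b.
case: (mxtens_indexP j) => c d; rewrite mxE sum_mxtens exchange_big /=.
transitivity (\sum_k st (u k b) * (adj t *m t) a c * u k d).
  apply: eq_bigr => k _; rewrite mxE mulr_sumr mulr_suml.
  by apply: eq_bigr => l _; rewrite !mxE !mxtens_indexK /= starM !mulrA.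
rewrite unitary_adjl //.
transitivity ((1%:M : 'M[A]_m) a c * (adj u *m u) b d).
  rewrite [(adj u *m u) _ _]mxE mulr_sumr; apply: eq_bigr => k _.
  by rewrite !mxE; case: (a == c); rewrite ?mulr1 ?mul1r // mulr0 !mul0r.
rewrite unitary_adjl // !mxE (can_eq (@mxtens_indexK _ _)) xpair_eqE.
by rewrite -natrM mulnb.
Qed.

Lemma unitary_one : unitary_corep st (1%:M : 'M[A]_1).
Proof.
apply: unitaryI; first exact: corep_one.
by rewrite -[1%:M](scalmx1 A) adj_scalmx -scalmxM trmx1 map_mx1 mulmx1.
Qed.

Lemma unitary_nil (t : 'M[A]_0) : unitary_corep st t.
Proof. by split=> [|[]//]; exact: corep_nil. Qed.

Lemma corep_star n (t : 'M[A]_n) : corep t -> corep (map_mx st t).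
Proof.
case: st_star => _ stD ste [tD te]; split=> i j; rewrite mxE.
  by rewrite stD tD (tmap_antilinear_sum starP); apply: eq_bigr => k _; rewrite !mxE.
by rewrite ste te conjC_nat.
Qed.

(** For a unitary t the matrix of the (t i j)^* is the transpose of S(t). *)
Lemma unitary_antipode_star n (t : 'M[A]_n) : unitary_corep st t ->
  S (map_mx st t) = (S (S t))^T.
Proof.
move/unitaryE => [_ ->]; rewrite /adj -!map_trmx trmxK //.
Qed.

End Star.

(** * Invariant subspaces and Schur's lemma *)
Section Splitting.
Variables (C : numClosedFieldType) (A : hopfAlgType C) (st : A -> A).
Hypothesis st_star : is_hopf_star st.
Local Notation sc := (scalmx A).

(** The hypothesis says that the row space of V is invariant. In an orthonormal
    basis adapted to that space and its orthogonal complement u becomes block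
    triangular, hence block diagonal because it stays unitary. *)
Lemma unitary_split n (u : 'M[A]_n) m (V : 'M[C]_(m, n)) (X : 'M[A]_m) :
  unitary_corep st u -> sc V *m u = X *m sc V ->
  exists (p q : nat) (W : 'M[C]_(p + q, n)) (u1 : 'M[A]_p) (u2 : 'M[A]_q),
  [/\ p = \rank V, (p + q)%N = n, W *m W^t* = 1%:M & W^t* *m W = 1%:M] /\
  [/\ unitary_corep st u1, unitary_corep st u2 &
      sc W *m u *m sc (W^t*) = block_mx u1 0 0 u2].
Proof.
move=> uu VX; set Vo := orthomx Num.conj (mx_of_hermitian (hermitian1mx _)) V.
pose W1 := schmidt (row_base V); pose W2 := schmidt (row_base Vo).
have Wu : col_mx W1 W2 \is unitarymx by exact: schmidt_complete_unitarymx.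
have W12 : W1 *m W2^t* = 0.
  apply/orthomx1P; rewrite /W1 /W2.
  do 2!rewrite eqmx_schmidt_free ?eq_row_base ?row_base_free // orthomx_sym.
have en : (\rank V + \rank Vo)%N = n by exact: add_rank_ortho.
have WW' : (col_mx W1 W2)^t* *m col_mx W1 W2 = 1%:M.
  by rewrite -[LHS]mul1mx mulmxA mulmxKtV.
have W1V : (W1 :=: V)%MS.
  by apply: eqmx_trans (eq_row_base V); apply: eqmx_schmidt_free; exact: row_base_free.
(* The rows of W1 span an invariant subspace. *)
have [Y W1Y] : exists Y, sc W1 *m u = Y *m sc W1.
  have /submxP[P W1P] : (W1 <= V)%MS by rewrite W1V.
  have /submxP[Q VQ] : (V <= W1)%MS by rewrite W1V.
  exists (sc P *m X *m sc Q).
  by rewrite -!mulmxA -[in RHS]scalmxM -VQ -VX mulmxA -scalmxM -W1P.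
pose u' := sc (col_mx W1 W2) *m u *m sc ((col_mx W1 W2)^t*).
have u'u : unitary_corep st u'.
  by apply: unitary_conj => //; apply/unitarymxP.
have ur0 : ursubmx u' = 0.
  have scW : sc (col_mx W1 W2) = col_mx (sc W1) (sc W2) by exact: map_col_mx.
  have scW' : sc ((col_mx W1 W2)^t*) = row_mx (sc (W1^t*)) (sc (W2^t*)).
    by rewrite tr_col_mx map_row_mx; apply: map_row_mx.
  rewrite /u' scW scW' mul_col_mx mul_col_row block_mxKur W1Y -mulmxA -scalmxM.
  by rewrite W12 scalmx0 mulmx0.
rewrite -[u']submxK ur0 in u'u.
have [dl0 u1u u2u] := unitary_block_inv st_star u'u.
exists _, _, (col_mx W1 W2), (ulsubmx u'), (drsubmx u'); split; split=> //.
  exact/unitarymxP.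
by rewrite -/u' -[in LHS](submxK u') ur0 dl0.
Qed.

Lemma irr_no_split n (u : 'M[A]_n) p q (W : 'M[C]_(p + q, n)) u1 u2 :
  (p + q)%N = n -> corep_irr u -> W^t* *m W = 1%:M ->
  sc W *m u *m sc (W^t*) = block_mx u1 0 0 u2 -> (p == 0)%N || (q == 0)%N.
Proof.
move=> en; case: n / en u W => u W [_ _ irr] WW Wu.
apply: contrapT => /negP; rewrite negb_or -!lt0n => /andP[p0 q0].
apply: irr; exists p, q, erefl, (block_mx u1 0 0 u2); split=> //.
  exists W; first by case/mulmx1_unit: WW.
  by rewrite castmx_id -Wu -mulmxA -scalmxM WW scalmx1 mulmx1.
by rewrite block_mxKdl.
Qed.

(** For an eigenvalue a of T, the rows killed by D = T - a form a nonzero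
    invariant subspace. It is the row space of V = 1 - D D', where D' is a
    pseudo-inverse of D, and Y = Y V for every matrix Y over A with Y D = 0. *)
Lemma schur n (u : 'M[A]_n) (T : 'M[C]_n) :
  unitary_corep st u -> corep_irr u -> sc T *m u = u *m sc T ->
  exists c, T = c%:M.
Proof.
move=> uu irr Tu; have n0 : (0 < n)%N by case: irr.
have [a /eigenvalueP[v vT v0]] := eigenvalue_closed T n0.
pose D := T - a%:M; pose V := 1%:M - D *m pinvmx D.
have VD : V *m D = 0 by rewrite mulmxBl mul1mx mulmxKpV ?subrr.
have Du : sc D *m u = u *m sc D.
  by rewrite scalmxB mulmxBl mulmxBr Tu scalmx_scalarC.
have Vu : sc V *m u = sc V *m u *m sc V.
  have eV : sc V = 1%:M - sc D *m sc (pinvmx D).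
    by rewrite -scalmxM -(scalmx1 A) -scalmxB.
  rewrite [X in _ = _ *m X]eV mulmxBr mulmx1 mulmxA.
  rewrite -[_ *m u *m sc D]mulmxA -Du mulmxA -scalmxM VD scalmx0 !mul0mx.
  by rewrite subr0.
have [p [q [W [u1 [u2 [[pV en WW WW'] [_ _ We]]]]]]] := unitary_split uu Vu.
case/orP: (irr_no_split en irr WW' We) => /eqP z.
  have V0 : V = 0 by apply/eqP; rewrite -mxrank_eq0 -pV z.
  case/eqP: v0; have DQ : D *m pinvmx D = 1%:M.
    by move/eqP: V0; rewrite subr_eq0 => /eqP.
  rewrite -[v]mulmx1 -DQ mulmxA mulmxBr vT mul_mx_scalar subrr mul0mx //.
have Vunit : V \in unitmx by rewrite -row_free_unit /row_free -pV -en z addn0.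
exists a; apply/eqP; rewrite -subr_eq0; apply/eqP.
by rewrite -/D -[D]mul1mx -(mulVmx Vunit) -mulmxA VD mulmx0.
Qed.

End Splitting.

(** * Positivity of the intertwiner of t and its double antipode *)
Lemma mxvec_dot (R : pzRingType) m n (X Y : 'M[R]_(m, n)) :
  (mxvec X *m (mxvec Y)^T) 0 0 = \tr (X *m Y^T).
Proof.
rewrite mxE (reindex _ (curry_mxvec_bij m n)) /=.
transitivity (\sum_i \sum_j
    mxvec X 0 (mxvec_index i j) * (mxvec Y)^T (mxvec_index i j) 0).
  by rewrite pair_bigA; apply: eq_bigr => -[].
apply: eq_bigr => i _; rewrite mxE; apply: eq_bigr => j _.
by rewrite [X in _ * X]mxE !mxvecE mxE.
Qed.

(** Choose M of maximal rank among the matrices whose row space lies in P. *)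
Lemma subspace_rowspace (K : fieldType) n (P : 'rV[K]_n -> Prop) :
  P 0 -> (forall k u v, P u -> P v -> P (k *: u + v)) ->
  exists M : 'M[K]_n, forall v, P v <-> (v <= M)%MS.
Proof.
move=> P0 Plin.
pose Q k := `[< exists2 M : 'M[K]_n, forall v, (v <= M)%MS -> P v & \rank M = k >].
have Q0 : exists k, Q k.
  exists 0%N; apply/asboolP; exists 0; last exact: mxrank0.
  by move=> v; rewrite submx0 => /eqP ->.
have Qn k : Q k -> (k <= n)%N by move=> /asboolP[M _ <-]; exact: rank_leq_row.
case: (ex_maxnP Q0 Qn) => k /asboolP[M MP rM] kmax.
exists M => v; split=> [Pv|]; last exact: MP.
have : Q (\rank (M + <<v>>)%MS).
  apply/asboolP; exists (M + <<v>>)%MS => // w /sub_addsmxP[[x y] /= ->].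
  have : (y *m <<v>> <= v)%MS by rewrite (submx_trans (submxMl _ _)) ?genmxE.
  move=> /sub_rVP[c ->]; rewrite addrC; apply: Plin => //.
  by apply: MP; exact: submxMl.
move/kmax; rewrite -rM => rle.
have : (M + <<v>> <= M)%MS.
  by rewrite -(geq_leqif (mxrank_leqif_sup (addsmxSl M <<v>>%MS))).
by rewrite addsmx_sub genmxE => /andP[].
Qed.

Section ConjugateCorep.
Variables (C : numClosedFieldType) (A : hopfAlgType C) (st : A -> A).
Hypothesis A_cqg : is_cqg st.
Local Notation sc := (scalmx A).
Local Notation S := (map_mx (@antipode C A)).

Let st_star : is_hopf_star st. Proof. by case: A_cqg. Qed.

Lemma cqg_ind (P : A -> Prop) : P 0 ->
  (forall k a b, P a -> P b -> P (k *: a + b)) ->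
  (forall n (t : 'M[A]_n) i j, unitary_corep st t -> P (t i j)) ->
  forall a, P a.
Proof.
move=> P0 Plin Pt a; have [m [c [x [Xx ->]]]] := proj2 A_cqg a.
apply: (big_ind P) => // [b b' Pb Pb'|i _].
  by rewrite -[b]scale1r; apply: Plin.
have [n [t [k [l [tu ->]]]]] := Xx i.
by rewrite -[_ *: _]addr0; apply: Plin => //; apply: Pt.
Qed.

Lemma star_scalar (phi : {scalar A}) : scalar (fun a => (phi (st (antipode a)))^*).
Proof.
move=> k a b; rewrite linearP (starD st_star) (starZ st_star) linearP.
by rewrite rmorphD rmorphM /= conjCK.
Qed.

(** The involution of the convolution algebra of functionals. *)
Definition scalar_star phi : {scalar A} := mkscalar (star_scalar phi).

(** The matrices phi(u), for u unitary, are thus closed under adjoints. *)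
Lemma scalar_star_unitary n (u : 'M[A]_n) phi : unitary_corep st u ->
  map_mx (scalar_star phi) u = (map_mx phi u)^t*.
Proof.
move=> [_ uS]; apply/matrixP => i j.
by rewrite !mxE /= uS (starK st_star).
Qed.

(** The trace form makes the linear combinations of the entries of u easy to
    evaluate under a functional, see scalar_coefficient. *)
Definition coefficient n (u : 'M[A]_n) (a : A) := exists c : 'M[C]_n, a = \tr (sc c *m u).

Lemma scalar_coefficient (phi : {scalar A}) n (u : 'M[A]_n) c :
  phi (\tr (sc c *m u)) = \tr (c *m map_mx phi u).
Proof.
rewrite /mxtrace linear_sum -scalar_sc_mul.
by apply: eq_bigr => i _; rewrite [RHS]mxE.
Qed.

Lemma coefficient_comb m n (u : 'M[A]_m) (v : 'M[A]_n) k a b :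
  coefficient u a -> coefficient v b ->
  coefficient (block_mx u 0 0 v) (k *: a + b).
Proof.
move=> [c ->] [d ->]; exists (block_mx (k *: c) 0 0 d).
rewrite /scalmx map_block_mx !map_mx0 mulmx_block !(mul0mx, mulmx0, addr0, add0r).
rewrite mxtrace_block -!/(scalmx A _); congr (_ + _).
rewrite /mxtrace scaler_sumr; apply: eq_bigr => i _.
rewrite !sc_mulE scaler_sumr; apply: eq_bigr => j _.
by rewrite !mxE scalerA.
Qed.

Lemma coefficient0 n (u : 'M[A]_n) : coefficient u 0.
Proof. by exists 0; rewrite scalmx0 mul0mx mxtrace0. Qed.

Lemma coefficient_entry n (u : 'M[A]_n) i j : coefficient u (u i j).
Proof.
exists (delta_mx j i); rewrite /mxtrace (bigD1 j) //= big1 => [|k kj].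
  rewrite sc_mulE (bigD1 i) //= big1 => [|l li]; last first.
    by rewrite mxE (negPf li) andbF scale0r.
  by rewrite mxE !eqxx scale1r !addr0.
by rewrite sc_mulE big1 // => l _; rewrite mxE (negPf kj) scale0r.
Qed.

Lemma coefficient_seq (s : seq A) :
  exists N (u : 'M[A]_N), unitary_corep st u /\ {in s, forall a, coefficient u a}.
Proof.
elim: s => [|a s [N [u [uu us]]]].
  by exists 0%N, 0; split=> //; exact: unitary_nil.
have [M [w [wu wa]]] : exists N (u : 'M[A]_N), unitary_corep st u /\ coefficient u a.
  elim/cqg_ind: a => [|k a b [m [w [wu wa]]] [n [x [xu xb]]]|n t i j tu].
  - exists 0%N, 0; split; [exact: unitary_nil | exact: coefficient0].
  - exists _, (block_mx w 0 0 x).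
    by split; [exact: unitary_block | exact: coefficient_comb].
  - by exists n, t; split=> //; exact: coefficient_entry.
exists _, (block_mx w 0 0 u); split; first exact: unitary_block.
move=> b; rewrite inE => /predU1P[->|bs].
  rewrite -[a]scale1r -[_ *: a]addr0; apply: coefficient_comb => //.
  exact: coefficient0.
have -> : b = 1 *: 0 + b by rewrite scaler0 add0r.
apply: coefficient_comb; last exact: us.
exact: coefficient0.
Qed.

Lemma lin_comb_scalar (k : C) (phi chi : {scalar A}) :
  scalar (fun a => k * phi a + chi a).
Proof.
by move=> c a b; rewrite !linearP /=; ring.
Qed.

(** Write a = tr(c u) and project c orthogonally onto the space of the matrices
    phi(u), which gives some psi(u). The remainder r is orthogonal to phi(u)†,
    which lies in that space, so that tr(r phi(u)) = 0. *)
Lemma coefficient_gram n (u : 'M[A]_n) a : unitary_corep st u -> coefficient u a ->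
  exists psi : {scalar A}, forall phi : {scalar A},
    phi a = \tr (map_mx psi u *m map_mx phi u).
Proof.
move=> uu [c ->].
pose P (v : 'rV_(n * n)) := exists phi : {scalar A}, v = mxvec (map_mx phi u).
have [||M MP] := @subspace_rowspace _ _ P.
- exists (mkscalar (lin_comb_scalar (-1) counit counit)).
  rewrite -[LHS](linear0 mxvec); congr mxvec.
  by apply/matrixP => i j; rewrite !mxE /= mulN1r addNr.
- move=> k _ _ [phi ->] [chi ->]; exists (mkscalar (lin_comb_scalar k phi chi)).
  by rewrite -linearP; congr mxvec; apply/matrixP => i j; rewrite !mxE.
have /MP[psi psiE] := proj_ortho_sub M (mxvec c).
exists psi => phi; rewrite scalar_coefficient; apply/eqP.
rewrite -subr_eq0 -linearB -mulmxBl /=.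
have /MP/submxP[D DE] : P (mxvec (map_mx (scalar_star phi) u)).
  by exists (scalar_star phi).
have -> : map_mx phi u = (map_mx Num.conj (map_mx (scalar_star phi) u))^T.
  by rewrite map_trmx scalar_star_unitary // trmxCK.
rewrite -mxvec_dot linearB /= -psiE -map_mxvec DE.
have /orthomx1P := proj_ortho_compl_sub M (mxvec c).
set r := (_ - _) => rM.
by rewrite map_mxM trmx_mul !map_trmx mulmxA rM mul0mx mxE.
Qed.

(** Let phi(v 0 m) = tr(B m phi(u)) with B m = psi_m(u). Evaluating the
    functional phi chi on v 0 j in two ways yields
    chi(u) B_j = sum_m chi(v m j) B_m, so the k-th columns of the B_m are the
    columns of a matrix T with [T] v = u [T]. Some k gives T <> 0, since the
    counit of v 0 0 is 1. *)
Lemma corep_to_unitary n (v : 'M[A]_n) : (0 < n)%N -> corep v ->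
  exists N (u : 'M[A]_N) (T : 'M[C]_(N, n)),
    [/\ unitary_corep st u, T != 0 & sc T *m v = u *m sc T].
Proof.
case: n v => // n v _ vc.
have [N [u [uu ucoef]]] := coefficient_seq [seq v ord0 m | m : 'I_n.+1].
have /choice[psi psiE] m : exists psi : {scalar A}, forall phi : {scalar A},
    phi (v ord0 m) = \tr (map_mx psi u *m map_mx phi u).
  by apply: coefficient_gram => //; apply: ucoef; apply: map_f; rewrite mem_enum.
pose B m := map_mx (psi m) u.
have uc : corep u by case: uu.
(* The defect of equivariance is orthogonal to the image of all functionals,
   to which it belongs. *)
have BX (chi : {scalar A}) j : map_mx chi u *m B j = \sum_m chi (v m j) *: B m.
  pose D := map_mx chi u *m B j - \sum_m chi (v m j) *: B m.
  have Dphi (phi : {scalar A}) : \tr (D *m map_mx phi u) = 0.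
    rewrite mulmxBl linearB /= mxtrace_mulC mulmxA mxtrace_mulC.
    rewrite -conv_corep // -psiE mulmx_suml linear_sum /=.
    have /matrixP/(_ ord0 j) := conv_corep vc phi chi.
    rewrite !mxE /= => ->; apply/eqP; rewrite subr_eq0; apply/eqP.
    apply: eq_bigr => m _; rewrite !mxE -scalemxAl linearZ /= -psiE mulrC //.
  apply/eqP; rewrite -subr_eq0 -/D; apply/eqP.
  apply: (posdef_trace_eq0 (posdef1 _ _)); rewrite mulmx1.
  have -> : D^t* = map_mx (scalar_star (conv chi (psi j))) u -
      \sum_m (chi (v m j))^* *: map_mx (scalar_star (psi m)) u.
    rewrite scalar_star_unitary // conv_corep // /D -/(B j).
    move: (_ *m B j) => Y; apply/matrixP => p q.
    rewrite !mxE !summxE rmorphB rmorph_sum; congr (_ - _).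
    by apply: eq_bigr => m _; rewrite scalar_star_unitary // !mxE rmorphM.
  have trB X Y : \tr (X - Y) = \tr X - \tr Y :> C by rewrite raddfB.
  have trS (G : 'I_n.+1 -> 'M[C]_N) : \tr (\sum_m G m) = \sum_m \tr (G m).
    by rewrite raddf_sum.
  rewrite mulmxBr trB Dphi mulmx_sumr trS big1 ?subrr // => m _.
  by rewrite -scalemxAr mxtraceZ Dphi mulr0.
have [i [k Bik]] : exists p k, B ord0 p k != 0.
  apply: contrapT => none; have := psiE ord0 counit.
  rewrite /= (proj2 vc) eqxx => /eqP; rewrite eq_sym; apply/negP.
  have -> : map_mx (psi ord0) u = 0.
    apply/matrixP => p k; apply: contrapT => nz; apply: none; exists p, k.
    by apply/eqP => z; apply: nz; rewrite -/(B ord0) z mxE.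
  by rewrite mul0mx mxtrace0 eq_sym oner_eq0.
exists N, u, (\matrix_(p, m) B m p k); split=> //.
  by apply: contraNneq Bik => /matrixP/(_ i ord0); rewrite !mxE => ->.
apply/matrixP => p j; apply/eqP; rewrite -subr_eq0; apply/eqP.
apply: scalar_separates => chi; rewrite linearB /= sc_mulE mul_scE !linear_sum /=.
have /matrixP/(_ p k) := BX chi j; rewrite summxE mxE => e.
apply/eqP; rewrite subr_eq0; apply/eqP; transitivity (\sum_m (chi (v m j) *: B m) p k).
  by apply: eq_bigr => m _; rewrite linearZ /= !mxE mulrC.
rewrite -e; apply: eq_bigr => q _; rewrite linearZ /= !mxE mulrC //.
Qed.

Lemma antipode_sqE n (t : 'M[A]_n) :
  map_mx (fun a => antipode (antipode a)) t = S (S t).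
Proof. by apply/matrixP => i j; rewrite !mxE. Qed.

(** Take adjoints in [T] t* = u [T] on the one hand and antipodes on the other:
    both sides then involve the adjoint of u, which can be eliminated. *)
Lemma star_intertwiner_gram n (t : 'M[A]_n) N (u : 'M[A]_N) (T : 'M[C]_(N, n)) :
  unitary_corep st t -> unitary_corep st u ->
  sc T *m map_mx st t = u *m sc T ->
  sc (T^t* *m T)^T *m t = S (S t) *m sc (T^t* *m T)^T.
Proof.
move=> tu /unitaryE[_ Su] Tt.
have aT : t^T *m sc (T^t*) = sc (T^t*) *m adj st u.
  have := congr1 (@adj _ _ st _ _) Tt; rewrite !(adjM st_star) (adj_scalmx st_star).
  move=> <-; congr (_^T *m _).
  by apply/matrixP => i j; rewrite !mxE (starK st_star).
have ST : sc T *m S (map_mx st t) = adj st u *m sc T.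
  by rewrite -map_sc_mul Tt map_mul_sc Su.
have : t^T *m sc (T^t* *m T) = sc (T^t* *m T) *m S (map_mx st t).
  by rewrite !scalmxM mulmxA aT -!mulmxA ST.
move/(congr1 trmx); rewrite tr_mul_sc tr_sc_mul trmxK => ->.
by rewrite (unitary_antipode_star tu) trmxK.
Qed.

(** Both F and (T† T)^T intertwine t and S²(t), so by irreducibility they are
    proportional; comparing traces shows that the factor is positive. *)
Lemma intertwiner_posdef n (t : 'M[A]_n) (F : 'M[C]_n) :
  unitary_corep st t -> corep_irr t -> antipode2_intertwiner t F -> posdef F.
Proof.
move=> tu tirr [Fu Ft _ Ftr]; rewrite antipode_sqE in Ft.
have n0 : (0 < n)%N by case: tirr.
have vc : corep (map_mx st t) by apply: corep_star => //; case: tu.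
have [N [u [T [uu T0 Tv]]]] := corep_to_unitary n0 vc.
have Pt := star_intertwiner_gram tu uu Tv; set P := T^t* *m T in Pt.
have FPt : sc (invmx F *m P^T) *m t = t *m sc (invmx F *m P^T).
  rewrite !scalmxM -mulmxA Pt mulmxA [RHS]mulmxA; congr (_ *m _).
  rewrite -[LHS]mulmx1 -(scalmxKV A Fu) mulmxA -[_ *m _ *m sc F]mulmxA -Ft.
  by rewrite mulmxA scalmxVK // mul1mx.
have [c cE] := schur st_star tu tirr FPt.
have PF : P^T = c *: F.
  by rewrite -mul_mx_scalar -cE mulKVmx.
have trP : \tr P = c * \tr F by rewrite -mxtraceZ -PF mxtrace_tr.
have P0 : 0 <= \tr P by rewrite /P mxtrace_mulC mxtrace_adj_ge0.
have c0 : 0 < c.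
  have := P0; rewrite trP pmulr_lge0 // le_eqVlt => /predU1P[c0|//].
  case/eqP: T0; apply: (posdef_trace_eq0 (posdef1 _ _)).
  by rewrite mulmx1 mxtrace_mulC -/P trP -c0 mul0r.
(* F = c^-1 (T† T)^T is the Gram matrix of a multiple of the conjugate of T. *)
pose Q := sqrtC c^-1 *: map_mx Num.conj T.
have FQ : F = Q^t* *m Q.
  have -> : Q^t* = (sqrtC c^-1)^* *: T^T.
    by apply/matrixP => i j; rewrite !mxE rmorphM /= conjCK.
  rewrite /Q -scalemxAl -scalemxAr scalerA.
  have -> : (sqrtC c^-1)^* = sqrtC c^-1.
    by apply/CrealP/ger0_real; rewrite sqrtC_ge0 invr_ge0 ltW.
  rewrite -expr2 sqrtCK.
  have -> : T^T *m map_mx Num.conj T = P^T by rewrite /P trmx_mul map_trmx trmxK.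
  by rewrite PF scalerA mulVf ?scale1r // gt_eqF.
by rewrite FQ; apply: posdef_gram; rewrite -FQ.
Qed.

End ConjugateCorep.

(** * Normalized intertwiners *)
Section Normalized.
Variables (C : numClosedFieldType) (A : hopfAlgType C) (st : A -> A).
Hypothesis st_star : is_hopf_star st.
Local Notation sc := (scalmx A).
Local Notation S := (map_mx (@antipode C A)).

Definition endo n (u : 'M[A]_n) (T : 'M[C]_n) := sc T *m u = u *m sc T.

(** For a reducible u the trace condition fixes the scale of G on every
    isotypic component at once. *)
Definition normalized n (u : 'M[A]_n) (G : 'M[C]_n) :=
  [/\ posdef G, sc G *m u = S (S u) *m sc G &
      forall T, endo u T -> \tr (T *m G) = \tr (T *m invmx G)].

Lemma intertwinerV n (u : 'M[A]_n) (G : 'M[C]_n) :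
  G \in unitmx -> sc G *m u = S (S u) *m sc G ->
  sc (invmx G) *m S (S u) = u *m sc (invmx G).
Proof.
move=> Gu Ge; rewrite -[LHS]mulmx1 -(scalmxKV A Gu) mulmxA.
by rewrite -[_ *m _ *m sc G]mulmxA -Ge mulmxA scalmxVK // mul1mx.
Qed.

Lemma endoM n (u : 'M[A]_n) T T' : endo u T -> endo u T' -> endo u (T *m T').
Proof. by rewrite /endo => e e'; rewrite scalmxM -mulmxA e' mulmxA e mulmxA. Qed.

Lemma endoB n (u : 'M[A]_n) T T' : endo u T -> endo u T' -> endo u (T - T').
Proof. by rewrite /endo => e e'; rewrite scalmxB mulmxBl e e' mulmxBr. Qed.

Lemma adj_intertwiner m n (u : 'M[A]_m) (v : 'M[A]_n) (T : 'M[C]_(m, n)) :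
  unitary_corep st u -> unitary_corep st v -> sc T *m v = u *m sc T ->
  sc (T^t*) *m u = v *m sc (T^t*).
Proof.
move=> uu vu /(congr1 (@adj _ _ st _ _)).
rewrite !(adjM st_star) (adj_scalmx st_star) => e.
rewrite -[LHS]mul1mx -(unitary_adjr vu) -mulmxA [adj st v *m _]mulmxA e.
by rewrite -[_ *m adj st u *m u]mulmxA unitary_adjl // mulmx1.
Qed.

Lemma normalized_endo n (u : 'M[A]_n) G H :
  normalized u G -> normalized u H -> endo u (invmx G *m H).
Proof.
move=> [Gp Ge _] [Hp He _]; rewrite /endo scalmxM -mulmxA He mulmxA.
by rewrite intertwinerV ?posdef_unit // mulmxA.
Qed.

(** The endomorphisms of u form an involutive algebra containing H^-1 G and
    H G^-1 = (G^-1 H)†. For X = H G^-1 - H^-1 G and T = X† the normalizations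
    give tr(T H) = tr(T H^-1) and tr(T H^-1 G G) = tr(T H^-1), that is,
    tr(X G X†) = 0. *)
Lemma normalized_uniq n (u : 'M[A]_n) G H : unitary_corep st u ->
  normalized u G -> normalized u H -> G = H.
Proof.
move=> uu Gn Hn; have [Gp _ Gtr] := Gn; have [Hp _ Htr] := Hn.
have [Gu Hu] := (posdef_unit Gp, posdef_unit Hp).
pose X := H *m invmx G - invmx H *m G.
have HG : endo u (H *m invmx G).
  have := adj_intertwiner uu uu (normalized_endo Gn Hn).
  rewrite trmx_mul map_mxM (posdef_herm Hp) trmx_inv map_invmx.
  by rewrite (posdef_herm Gp).
have Xe : endo u X by apply: endoB => //; exact: normalized_endo.
have XG : \tr (X *m G *m X^t*) = 0.
  rewrite mxtrace_mulC mulmxA /X.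
  set T := X^t*; have Te : endo u T by exact: adj_intertwiner.
  have trB Y Z : \tr (Y - Z) = \tr Y - \tr Z :> C by rewrite raddfB.
  rewrite mulmxBr mulmxBl trB -!mulmxA mulVmx // mulmx1 Htr //.
  have := Gtr _ (endoM Te (normalized_endo Hn Gn)).
  by rewrite -!mulmxA mulmxV // mulmx1 => ->; rewrite subrr.
have /eqP := posdef_trace_eq0 Gp XG; rewrite subr_eq0 => /eqP e.
apply: posdef_sqr_inj => //.
have := congr1 (fun Y => H *m Y *m G) e.
by rewrite !mulmxA mulmxKV // mulmxV // mul1mx.
Qed.

Lemma normalized_conj n (u : 'M[A]_n) (W G : 'M[C]_n) : W \is unitarymx ->
  normalized u G ->
  normalized (sc (invmx W) *m u *m sc W) (invmx W *m G *m W).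
Proof.
move=> Wu [Gp Ge Gtr]; have Wun := unitarymx_unit Wu; split.
- exact: posdef_conj.
- rewrite !map_mul_sc !map_sc_mul !scalmxM !mulmxA.
  rewrite -[_ *m sc W *m sc (invmx W)]mulmxA scalmxKV // mulmx1.
  rewrite -[_ *m sc G *m u]mulmxA Ge !mulmxA.
  by rewrite -[_ *m sc W *m sc (invmx W)]mulmxA scalmxKV // mulmx1.
move=> T Te; have Te' : endo u (W *m T *m invmx W).
  rewrite /endo !scalmxM; have := congr1 (fun Y => sc W *m Y *m sc (invmx W)) Te.
  rewrite /= !mulmxA => e.
  have := e; rewrite -[_ *m sc W *m sc (invmx W)]mulmxA scalmxKV // mulmx1 => ->.
  by rewrite mul1mx.
have Gu := posdef_unit Gp.
have -> : invmx (invmx W *m G *m W) = invmx W *m invmx G *m W.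
  apply: (@row_full_inj _ _ _ _ (invmx W *m G *m W)).
    by rewrite row_full_unit !unitmx_mul unitmx_inv Wun Gu.
  rewrite mulmxV ?unitmx_mul ?unitmx_inv ?Wun ?Gu // !mulmxA.
  by rewrite mulmxK // mulmxK // mulVmx.
have := Gtr _ Te'; rewrite -!mulmxA ![\tr (W *m _)]mxtrace_mulC.
by rewrite !mulmxA.
Qed.

Lemma normalized_block m n (u : 'M[A]_m) (v : 'M[A]_n) G H :
  normalized u G -> normalized v H ->
  normalized (block_mx u 0 0 v) (block_mx G 0 0 H).
Proof.
move=> [Gp Ge Gtr] [Hp He Htr]; split.
- exact: posdef_block.
- rewrite !map_block_mx !map_mx0 /scalmx map_block_mx !map_mx0 !mulmx_block.
  by rewrite !(mul0mx, mulmx0, addr0, add0r) -!/(scalmx A _) Ge He.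
move=> T Te; move: Te; rewrite -[T]submxK /endo /scalmx map_block_mx !mulmx_block.
rewrite !(mul0mx, mulmx0, addr0, add0r) => /eq_block_mx[Te1 _ _ Te2].
rewrite invmx_block_diag; last first.
  by rewrite unitmxE det_lblock unitrM -!unitmxE !posdef_unit.
rewrite !mulmx_block !mxtrace_block !(mul0mx, mulmx0, addr0, add0r).
by rewrite Gtr // Htr.
Qed.

Lemma normalized_irr n (u : 'M[A]_n) F : unitary_corep st u -> corep_irr u ->
  posdef F -> antipode2_intertwiner u F -> normalized u F.
Proof.
move=> uu uirr Fp [_ Fe Ftr _]; split=> //.
  by rewrite Fe; congr (_ *m _); apply/matrixP => i j; rewrite !mxE.
move=> T Te; have [c ->] := schur st_star uu uirr Te.
by rewrite !mul_scalar_mx !mxtraceZ Ftr.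
Qed.

End Normalized.

(** * Tensor products of normalized intertwiners *)
Section TensorProducts.
Variables (C : numClosedFieldType) (A : hopfAlgType C) (st : A -> A).
Hypothesis A_cqg : is_cqg st.
Local Notation sc := (scalmx A).
Local Notation S := (map_mx (@antipode C A)).

Let st_star : is_hopf_star st. Proof. by case: A_cqg. Qed.

(** On the entries of a unitary u the antipode is u i j |-> (u j i)^*, which
    reverses products, and u *t w is unitary along with u and w. *)
Lemma antipodeM (a b : A) : antipode (a * b) = antipode b * antipode a.
Proof.
elim/(cqg_ind A_cqg): a => [|k a a' Ha Ha'|m u i j uu].
- by rewrite mul0r !linear0 mulr0.
- by rewrite mulrDl -scalerAl !antipode_linear Ha Ha' mulrDr scalerAr.
elim/(cqg_ind A_cqg): b => [|k b b' Hb Hb'|n w k l wu].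
- by rewrite mulr0 !linear0 mul0r.
- by rewrite mulrDr -scalerAr !antipode_linear Hb Hb' mulrDl scalerAl.
have [_ uS] := uu; have [_ wS] := wu.
have [_ /(_ (mxtens_index (i, k)) (mxtens_index (j, l)))] :=
  unitary_tens st_star uu wu.
by rewrite !tensmxE (starM st_star) => ->; rewrite uS wS.
Qed.

Lemma tens_sc_mul m n p q m' p' (X : 'M[C]_(m', m)) (Y : 'M[C]_(p', p))
    (u : 'M[A]_(m, n)) (w : 'M[A]_(p, q)) :
  sc (X *t Y) *m (u *t w) = (sc X *m u) *t (sc Y *m w).
Proof.
apply/matrixP => i j; case: (mxtens_indexP i) => a b.
case: (mxtens_indexP j) => c d; rewrite tensmxE !sc_mulE sum_mxtens mulr_suml.
apply: eq_bigr => k _; rewrite mulr_sumr; apply: eq_bigr => l _.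
by rewrite !tensmxE -scalerAl -scalerAr scalerA.
Qed.

Lemma tens_mul_sc m n p q n' q' (X : 'M[C]_(n, n')) (Y : 'M[C]_(q, q'))
    (u : 'M[A]_(m, n)) (w : 'M[A]_(p, q)) :
  (u *t w) *m sc (X *t Y) = (u *m sc X) *t (w *m sc Y).
Proof.
apply/matrixP => i j; case: (mxtens_indexP i) => a b.
case: (mxtens_indexP j) => c d; rewrite tensmxE !mul_scE sum_mxtens mulr_suml.
apply: eq_bigr => k _; rewrite mulr_sumr; apply: eq_bigr => l _.
by rewrite !tensmxE -scalerAl -scalerAr scalerA.
Qed.

Lemma map_antipode_sq_tens m n (u : 'M[A]_m) (w : 'M[A]_n) :
  S (S (u *t w)) = S (S u) *t S (S w).
Proof.
apply/matrixP => i j; rewrite !mxE !antipodeM //.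
Qed.

Lemma trace_scE n (X : 'M[C]_n) (Y : 'M[A]_n) :
  \tr (sc X *m Y) = \sum_i \sum_j X i j *: Y j i.
Proof. by apply: eq_bigr => i _; rewrite sc_mulE. Qed.

Lemma trace_sum_scale m n (H : 'M[C]_n) (c : 'I_m -> 'I_n -> 'I_n -> C)
    (X : 'I_m -> A) :
  \sum_k (\sum_l \sum_j H l j * c k j l) *: X k =
  \tr (sc H *m \matrix_(j, l) \sum_k c k j l *: X k).
Proof.
transitivity (\sum_k \sum_l \sum_j H l j *: (c k j l *: X k)).
  apply: eq_bigr => k _; rewrite scaler_suml; apply: eq_bigr => l _.
  by rewrite scaler_suml; apply: eq_bigr => j _; rewrite scalerA.
rewrite trace_scE exchange_big; apply: eq_bigr => l _.
rewrite exchange_big; apply: eq_bigr => j _.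
by rewrite mxE scaler_sumr.
Qed.

Lemma tr_antipode n (w : 'M[A]_n) : unitary_corep st w -> (S w)^T = map_mx st w.
Proof. by move=> /unitaryE[_ ->]; rewrite trmxK. Qed.

(** The hypothesis reads sum_l x j l w l q = sum_l y l q w j l, where w stands
    on the right on both sides. Solving it for x by the inverse S(w) and
    taking the trace against H brings together w j l, S(w q r) and H r j, whose
    sum over j and r is H q l because [H] w = S²(w) [H]. *)
Lemma trace_transfer_right n (w : 'M[A]_n) (H : 'M[C]_n) (x y : 'M[A]_n) :
  unitary_corep st w -> sc H *m w = S (S w) *m sc H ->
  x *m w = (y^T *m w^T)^T -> \tr (sc H *m x) = \tr (sc H *m y).
Proof.
move=> wu He e; have wc : corep w by case: wu.
have swc := corep_star st_star wc.
have I1 : (sc H *m w)^T *m (S w)^T = sc H^T.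
  rewrite He tr_mul_sc -(unitary_antipode_star wu) tr_antipode // -mulmxA.
  by rewrite corep_mulVl // mulmx1.
have -> : x = (y^T *m w^T)^T *m S w by rewrite -e -mulmxA corep_mulV // mulmx1.
transitivity (\sum_q \sum_l y l q * ((sc H *m w)^T *m (S w)^T) l q).
  rewrite trace_scE.
  transitivity (\sum_r \sum_j \sum_q \sum_l
      y l q * (H r j *: (w j l * antipode (w q r)))).
    apply: eq_bigr => r _; apply: eq_bigr => j _; rewrite mxE scaler_sumr.
    apply: eq_bigr => q _; rewrite !mxE mulr_suml scaler_sumr.
    by apply: eq_bigr => l _; rewrite !mxE -mulrA scalerAr.
  under eq_bigr => r _ do rewrite exchange_big.
  rewrite exchange_big; apply: eq_bigr => q _ /=.
  under eq_bigr => r _ do rewrite exchange_big.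
  rewrite exchange_big; apply: eq_bigr => l _ /=.
  rewrite mxE mulr_sumr; apply: eq_bigr => r _; rewrite !mxE mulr_suml mulr_sumr.
  by apply: eq_bigr => j _; rewrite mxE mulr_algl -scalerAl.
rewrite I1 trace_scE; apply: eq_bigr => q _; apply: eq_bigr => l _.
by rewrite !mxE mulr_algr.
Qed.

(** The mirror image of trace_transfer_right, with u on the left; there the
    relation between S(u), u and S²(u) calls for the inverse of G. *)
Lemma trace_transfer_left n (u : 'M[A]_n) (G : 'M[C]_n) (x y : 'M[A]_n) :
  unitary_corep st u -> G \in unitmx -> sc G *m u = S (S u) *m sc G ->
  u *m y = (u^T *m x^T)^T ->
  \tr (sc (invmx G) *m x) = \tr (sc (invmx G) *m y).
Proof.
move=> uu Gu Ge e; have uc : corep u by case: uu.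
have suc := corep_star st_star uc; set K := invmx G.
have I2 : (S u)^T *m (u *m sc K)^T = sc K^T.
  rewrite -(intertwinerV Gu Ge) tr_sc_mul -(unitary_antipode_star uu).
  rewrite tr_antipode // mulmxA.
  by rewrite corep_mulV // mul1mx.
have -> : y = S u *m (u^T *m x^T)^T by rewrite -e mulmxA corep_mulVl // mul1mx.
transitivity (\sum_k \sum_i ((S u)^T *m (u *m sc K)^T) i k * x i k).
  rewrite I2 trace_scE; apply: eq_bigr => k _; apply: eq_bigr => i _.
  by rewrite !mxE mulr_algl.
rewrite trace_scE; symmetry.
transitivity (\sum_p \sum_r \sum_i \sum_k
    (K p r *: (antipode (u r i) * u k p)) * x i k).
  apply: eq_bigr => p _; apply: eq_bigr => r _; rewrite mxE scaler_sumr.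
  apply: eq_bigr => i _; rewrite !mxE mulr_sumr scaler_sumr.
  by apply: eq_bigr => k _; rewrite !mxE mulrA -scalerAl.
rewrite exchange_big; under eq_bigr => r _ do rewrite exchange_big.
rewrite exchange_big [RHS]exchange_big; apply: eq_bigr => i _ /=.
under eq_bigr => r _ do rewrite exchange_big.
rewrite exchange_big; apply: eq_bigr => k _ /=.
rewrite mxE mulr_suml; apply: eq_bigr => r _; rewrite !mxE mulr_sumr mulr_suml.
by apply: eq_bigr => p _; rewrite mxE mulr_algr scalerAr.
Qed.

Section PartialTraces.
Variables (m n : nat) (T : 'M[C]_(m * n)).

Let t i j k l := T (mxtens_index (i, j)) (mxtens_index (k, l)).

(** The partial traces (id (x) tr)(T (1 (x) H)) and
    (tr (x) id)(T (K (x) 1)). *)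
Definition ptrace_right (H : 'M[C]_n) : 'M[C]_m :=
  \matrix_(i, k) \sum_l \sum_j H l j * t i j k l.
Definition ptrace_left (K : 'M[C]_m) : 'M[C]_n :=
  \matrix_(j, l) \sum_k \sum_i K k i * t i j k l.

Lemma mxtrace_tens (G : 'M[C]_m) (H : 'M[C]_n) :
  \tr (T *m (G *t H)) = \sum_i \sum_j \sum_k \sum_l t i j k l * (G k i * H l j).
Proof.
rewrite /mxtrace sum_mxtens; apply: eq_bigr => i _; apply: eq_bigr => j _.
rewrite mxE sum_mxtens; apply: eq_bigr => k _; apply: eq_bigr => l _.
by rewrite tensmxE.
Qed.

Lemma mxtrace_ptrace_right G H : \tr (T *m (G *t H)) = \tr (ptrace_right H *m G).
Proof.
rewrite mxtrace_tens; apply: eq_bigr => i _; rewrite mxE exchange_big /=.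
apply: eq_bigr => k _; rewrite mxE mulr_suml exchange_big /=.
apply: eq_bigr => l _; rewrite mulr_suml; apply: eq_bigr => j _.
by ring.
Qed.

Lemma mxtrace_ptrace_left G H : \tr (T *m (G *t H)) = \tr (ptrace_left G *m H).
Proof.
rewrite mxtrace_tens exchange_big; apply: eq_bigr => j _ /=; rewrite mxE.
under eq_bigr => i _ do rewrite exchange_big.
rewrite exchange_big; apply: eq_bigr => l _ /=; rewrite mxE mulr_suml exchange_big /=.
apply: eq_bigr => k _; rewrite mulr_suml; apply: eq_bigr => i _.
by ring.
Qed.

Variables (u : 'M[A]_m) (w : 'M[A]_n).
Hypotheses (uu : unitary_corep st u) (wu : unitary_corep st w).
Hypothesis Te : endo (u *t w) T.

Let entry i j p q : \sum_k \sum_l t i j k l *: (u k p * w l q) =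
  \sum_k \sum_l t k l p q *: (u i k * w j l).
Proof.
have /matrixP/(_ (mxtens_index (i, j)) (mxtens_index (p, q))) := Te.
rewrite sc_mulE mul_scE !sum_mxtens => e.
transitivity (\sum_i0 \sum_j0 T (mxtens_index (i, j)) (mxtens_index (i0, j0)) *:
       (u *t w) (mxtens_index (i0, j0)) (mxtens_index (p, q))).
  by apply: eq_bigr => k _; apply: eq_bigr => l _; rewrite tensmxE.
rewrite e.
by apply: eq_bigr => k _; apply: eq_bigr => l _; rewrite tensmxE.
Qed.

Lemma ptrace_right_endo H : sc H *m w = S (S w) *m sc H ->
  endo u (ptrace_right H).
Proof.
move=> He; apply/matrixP => i p; rewrite sc_mulE mul_scE.
under eq_bigr => k _ do rewrite mxE.
under [RHS]eq_bigr => k _ do rewrite mxE.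
rewrite !trace_sum_scale; apply: (trace_transfer_right wu He).
apply/matrixP => j q; rewrite !mxE.
transitivity (\sum_l \sum_k t i j k l *: (u k p * w l q)).
  apply: eq_bigr => l _; rewrite mxE mulr_suml.
  by apply: eq_bigr => k _; rewrite scalerAl.
rewrite exchange_big entry exchange_big; apply: eq_bigr => l _ /=.
by rewrite !mxE mulr_suml; apply: eq_bigr => k _; rewrite scalerAl.
Qed.

Lemma ptrace_left_endo G : G \in unitmx -> sc G *m u = S (S u) *m sc G ->
  endo w (ptrace_left (invmx G)).
Proof.
move=> Gu Ge; apply/matrixP => j q; rewrite sc_mulE mul_scE.
under eq_bigr => k _ do rewrite mxE.
under [RHS]eq_bigr => k _ do rewrite mxE.
rewrite (trace_sum_scale _ (fun l i k => t i j k l)).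
rewrite (trace_sum_scale _ (fun l i k => t i l k q)).
apply: (trace_transfer_left uu Gu Ge).
apply/matrixP => i p; rewrite !mxE.
transitivity (\sum_k \sum_l t k l p q *: (u i k * w j l)).
  apply: eq_bigr => k _; rewrite mxE mulr_sumr.
  by apply: eq_bigr => l _; rewrite scalerAr.
rewrite -entry; apply: eq_bigr => k _.
by rewrite !mxE mulr_sumr; apply: eq_bigr => l _; rewrite scalerAr.
Qed.

End PartialTraces.

(** The right partial trace changes the exponent of G, the left one that of H. *)
Lemma normalized_tens m n (u : 'M[A]_m) (w : 'M[A]_n) G H :
  unitary_corep st u -> unitary_corep st w ->
  normalized u G -> normalized w H -> normalized (u *t w) (G *t H).
Proof.
move=> uu wu [Gp Ge Gtr] [Hp He Htr].
have [Gu Hu] := (posdef_unit Gp, posdef_unit Hp); split.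
- exact: posdef_tens.
- by rewrite tens_sc_mul Ge He -tens_mul_sc map_antipode_sq_tens.
move=> T Te; have -> : invmx (G *t H) = invmx G *t invmx H.
  apply: (@row_full_inj _ _ _ _ (G *t H)).
    by rewrite row_full_unit posdef_unit //; exact: posdef_tens.
  rewrite mulmxV; last by apply/posdef_unit/posdef_tens.
  rewrite tensmx_mul !mulmxV //; apply/matrixP => i j.
  case: (mxtens_indexP i) => a b; case: (mxtens_indexP j) => c d.
  rewrite tensmxE !mxE (can_eq (@mxtens_indexK _ _)) xpair_eqE.
  by rewrite -natrM mulnb.
rewrite mxtrace_ptrace_right Gtr; last exact: (ptrace_right_endo wu Te He).
rewrite -mxtrace_ptrace_right !mxtrace_ptrace_left Htr //.
exact: (ptrace_left_endo uu Te Gu Ge).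
Qed.

End TensorProducts.

(** * The functionals f_z are characters *)
Section Characters.
Variables (C : numClosedFieldType) (A : hopfAlgType C) (st : A -> A).
Hypothesis A_cqg : is_cqg st.
Variables (I : Type) (d : I -> nat) (t : forall i, 'M[A]_(d i)).
Hypothesis t_irr : irr_unitary_system st t.
Variable F : forall i, 'M[C]_(d i).
Hypothesis F_def : forall i, antipode2_intertwiner (t i) (F i).
Variable pow : C -> C -> C.
Hypothesis pow_laws : power_laws pow.
Variable f : C -> {scalar A}.
Hypothesis f_def : forall z i k l, f z (t i k l) = mxpow pow (F i) z k l.
Local Notation sc := (scalmx A).
Local Notation S := (map_mx (@antipode C A)).

Let st_star : is_hopf_star st. Proof. by case: A_cqg. Qed.

(** As G is unique, this says that f_z(u) = G^z for the normalized G of u; in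
    this form the property passes to direct sums and unitary conjugates. *)
Definition has_powers n (u : 'M[A]_n) := exists G : 'M[C]_n,
  normalized u G /\ forall z, map_mx (f z) u = mxpow pow G z.

Lemma has_powers_conj n (u : 'M[A]_n) (W : 'M[C]_n) : W \is unitarymx ->
  has_powers u -> has_powers (sc (invmx W) *m u *m sc W).
Proof.
move=> Wu [G [Gn Gf]]; exists (invmx W *m G *m W); split.
  exact: normalized_conj.
by move=> z; rewrite scalar_mul_sc scalar_sc_mul Gf mxpow_conj //; case: Gn.
Qed.

Lemma has_powers_block m n (u : 'M[A]_m) (v : 'M[A]_n) :
  has_powers u -> has_powers v -> has_powers (block_mx u 0 0 v).
Proof.
move=> [G [Gn Gf]] [H [Hn Hf]]; exists (block_mx G 0 0 H); split.
  exact: normalized_block.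
move=> z; rewrite map_block_mx !map_mx0 Gf Hf mxpow_block //.
  by case: Gn.
by case: Hn.
Qed.

Lemma has_powers_system i : has_powers (t i).
Proof.
have [tu _ _] := t_irr; have [tiu tii] := tu i.
exists (F i); split; last first.
  by move=> z; apply/matrixP => k l; rewrite mxE f_def.
apply: (normalized_irr st_star) => //.
exact: (intertwiner_posdef A_cqg tiu tii).
Qed.

(** If B intertwines the unitary matrices s and u, then B† B is an endomorphism
    of s, hence a positive scalar, and rescaling B makes it unitary. *)
Lemma has_powers_equiv n (s u : 'M[A]_n) : unitary_corep st s -> unitary_corep st u ->
  corep_irr s -> corep_equiv s u -> has_powers s -> has_powers u.
Proof.
move=> su uu sirr [B Bu Be] sp; have n0 : (0 < n)%N by case: sirr.
have Bsu := adj_intertwiner st_star uu su Be.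
have BB : endo s (B^t* *m B).
  by rewrite /endo scalmxM -mulmxA Be mulmxA Bsu mulmxA.
have [c cE] := schur st_star su sirr BB.
have c0 : 0 < c.
  rewrite lt_def; apply/andP; split.
    apply: contraTneq Bu => c0; have B0 : B = 0.
      apply: (posdef_trace_eq0 (posdef1 _ _)).
      by rewrite mulmx1 mxtrace_mulC cE c0 mxtrace_scalar mul0rn.
    by rewrite -row_free_unit /row_free B0 mxrank0 eq_sym -lt0n.
  have := mxtrace_adj_ge0 B; rewrite mxtrace_mulC cE mxtrace_scalar.
  by rewrite pmulrn_lge0.
pose k := (sqrtC c)^-1; pose W := k *: B.
have kr : k^* = k.
  by apply/CrealP/ger0_real; rewrite invr_ge0 sqrtC_ge0 ltW.
have kk : k * k * c = 1.
  by rewrite -expr2 exprVn sqrtCK mulVf // gt_eqF.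
have Wa : W^t* = k *: B^t*.
  by apply/matrixP => i j; rewrite !mxE rmorphM /= kr.
have WW : W^t* *m W = 1%:M.
  rewrite Wa -scalemxAl -scalemxAr scalerA cE scale_scalar_mx kk //.
have Wau : W^t* \is unitarymx by apply/unitarymxP; rewrite trmxCK.
have -> : u = sc (invmx (W^t*)) *m s *m sc (W^t*).
  have iW : invmx (W^t*) = W by rewrite invmx_unitary // trmxCK.
  have Ws : sc W *m s = u *m sc W.
    rewrite /W -mul_scalar_mx !scalmxM -mulmxA Be [LHS]mulmxA scalmx_scalarC.
    by rewrite mulmxA.
  rewrite iW Ws -mulmxA -scalmxM.
  by rewrite (mulmx1C WW) scalmx1 mulmx1.
exact: has_powers_conj.
Qed.

(** Induction on the size, splitting off the orthogonal complement of an
    invariant subspace when u is reducible. *)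
Lemma has_powers_unitary n (u : 'M[A]_n) : unitary_corep st u -> has_powers u.
Proof.
elim/ltn_ind: n u => n IH u uu.
have [uirr|nirr] := pselect (corep_irr u).
  have [tu tsys _] := t_irr; have [i [e eqv]] := tsys _ _ uu uirr.
  case: n / e u eqv uu uirr {IH} => u; rewrite castmx_id => eqv uu uirr.
  have [tiu tii] := tu i.
  exact: has_powers_equiv eqv (has_powers_system i).
have [n0|n0] := posnP n.
  subst n; exists 1%:M; split; last by move=> z; apply/matrixP => -[].
  split; [exact: posdef1 | by apply/matrixP => -[] |].
  by move=> T _; rewrite /mxtrace !big_ord0.
have [p [q [e [s [p0 q0 [B Bu Be] s0]]]]] : exists p q (e : n = (p + q)%N) s,
    [/\ (0 < p)%N, (0 < q)%N, corep_equiv (castmx (e, e) u) s & dlsubmx s = 0].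
  by apply: contrapT => no; apply: nirr; split=> //; case: uu.
subst n; rewrite castmx_id in Be.
(* As s is block upper triangular, the last q rows of B span an invariant
   subspace. *)
pose V := dsubmx B.
have Vu : sc V *m u = drsubmx s *m sc V.
  have eB : sc B = col_mx (sc (usubmx B)) (sc V).
    by rewrite /scalmx -map_col_mx vsubmxK.
  have es : s = block_mx (ulsubmx s) (ursubmx s) 0 (drsubmx s).
    by rewrite -s0 submxK.
  move: Be; rewrite {1}es eB mul_col_mx mul_block_col mul0mx add0r.
  by move/eq_col_mx => [].
have [p' [q' [W [u1 [u2 [[pV en WW WW'] [u1u u2u We]]]]]]] := unitary_split st_star uu Vu.
have p'0 : (0 < p')%N.
  rewrite pV lt0n mxrank_eq0; apply/eqP => V0.
  have : row_mx (0 : 'M_(q, p)) 1%:M = 0 :> 'M[C]_(q, p + q).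
    rewrite -[LHS]mulmx1 -(mulmxV Bu) mulmxA -{1}[B]vsubmxK mul_row_col.
    by rewrite mul0mx mul1mx add0r -/V V0 mul0mx.
  move/(congr1 rsubmx); rewrite row_mxKr => /matrixP/(_ (Ordinal q0) (Ordinal q0)).
  by rewrite !mxE eqxx => /eqP; rewrite oner_eq0.
have p'n : (p' < p + q)%N.
  by rewrite pV (leq_ltn_trans (rank_leq_row _)) // -[X in (X < _)%N]add0n ltn_add2r.
have q'n : (q' < p + q)%N by rewrite -en -[X in (X < _)%N]add0n ltn_add2r.
have P1 := IH _ p'n _ u1u; have P2 := IH _ q'n _ u2u.
have := has_powers_block P1 P2; rewrite -We.
move: (p + q)%N en u uu W WW WW' {IH Vu Bu Be s0 nirr V pV B s p'n q'n n0 We}.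
move=> n en; case: n / en => u uu W WW WW'.
have Wu : W \is unitarymx by apply/unitarymxP.
move/(has_powers_conj Wu); rewrite invmx_unitary // !mulmxA -scalmxM WW' scalmx1.
by rewrite mul1mx -mulmxA -scalmxM WW' scalmx1 mulmx1.
Qed.

Lemma normalized_power n (u : 'M[A]_n) G z : unitary_corep st u ->
  normalized u G -> map_mx (f z) u = mxpow pow G z.
Proof.
move=> uu Gn; have [H [Hn ->]] := has_powers_unitary uu.
by rewrite (normalized_uniq st_star uu Hn Gn).
Qed.

(** By normalized_tens and uniqueness the normalized intertwiner of u *t w is
    the Kronecker product, and powers commute with Kronecker products. *)
Lemma power_tens z m n (u : 'M[A]_m) (w : 'M[A]_n) :
  unitary_corep st u -> unitary_corep st w ->
  map_mx (f z) (u *t w) = map_mx (f z) u *t map_mx (f z) w.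
Proof.
move=> uu wu; have [G [Gn Gf]] := has_powers_unitary uu.
have [H [Hn Hf]] := has_powers_unitary wu.
have GHn := normalized_tens A_cqg uu wu Gn Hn.
rewrite (normalized_power _ (unitary_tens st_star uu wu) GHn) Gf Hf.
by apply: (mxpow_tens pow_laws); [case: Gn | case: Hn].
Qed.

(** Read power_tens entrywise: the entries of u *t w are the products of those
    of u and w. *)
Lemma power_mul z (a b : A) : f z (a * b) = f z a * f z b.
Proof.
elim/(cqg_ind A_cqg): a => [|k a a' Ha Ha'|m u i j uu].
- by rewrite mul0r !linear0 mul0r.
- by rewrite mulrDl -scalerAl !linearP Ha Ha' mulrDl mulrA.
elim/(cqg_ind A_cqg): b => [|k b b' Hb Hb'|n w k l wu].
- by rewrite mulr0 !linear0 mulr0.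
- by rewrite mulrDr -scalerAr !linearP Hb Hb' mulrDr mulrCA.
have /matrixP/(_ (mxtens_index (i, k)) (mxtens_index (j, l))) := power_tens z uu wu.
by rewrite tensmxE !mxE !mxtens_indexK.
Qed.

(** The value is idempotent by multiplicativity, and invertible because
    it is a power of the normalized intertwiner of the trivial
    corepresentation. *)
Lemma power_one z : f z 1 = 1.
Proof.
have n1 : normalized (1%:M : 'M[A]_1) 1%:M.
  split; first exact: posdef1.
    have S1 : S (1%:M : 'M[A]_1) = 1%:M.
      by rewrite -[LHS]mul1mx corep_mulV //; exact: corep_one.
    by rewrite !S1 scalmx1.
  by move=> T _; rewrite invmx1.
have x y : f y 1 = mxpow pow (1%:M : 'M[C]_1) y 0 0.
  have := normalized_power y (unitary_one st_star) n1.
  by move/matrixP/(_ 0 0); rewrite !mxE eqxx.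
have /matrixP/(_ 0 0) := mxpowNK pow_laws z (posdef1 C 1).
rewrite mxE big_ord1 -!x mxE eqxx => fV.
have f0 : f z 1 != 0.
  by apply: contra_eq_neq fV => ->; rewrite mulr0 eq_sym oner_eq0.
by apply: (mulfI f0); rewrite -power_mul !mulr1.
Qed.

(** A character takes the inverse S(u) of u to the inverse of f_z(u) = G^z. *)
Lemma power_star n (u : 'M[A]_n) G z : unitary_corep st u -> normalized u G ->
  map_mx (f z) (map_mx st u) = (mxpow pow G (- z))^T.
Proof.
move=> uu Gn; have Gp : posdef G by case: Gn.
have uc : corep u by case: uu.
rewrite -tr_antipode // -map_trmx; congr (_^T).
rewrite -[LHS]mul1mx -(mxpowNK pow_laws z Gp) -mulmxA.
rewrite -(normalized_power z uu Gn).
have -> : map_mx (f z) u *m map_mx (f z) (S u) = 1%:M.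
  have /matrixP e := corep_mulV uc; apply/matrixP => i j.
  have := congr1 (f z) (e i j); rewrite !mxE linear_sum => e'.
  transitivity (f z (i == j)%:R); last first.
    by case: (i == j); rewrite ?linear0 ?power_one.
  by rewrite -e'; apply: eq_bigr => k _; rewrite power_mul !mxE.
by rewrite mulmx1.
Qed.

Lemma linear_at0 (g : A -> A) : linear g -> g 0 = 0.
Proof.
move=> gl; have := gl (-1) 0 0.
by rewrite scaler0 addr0 scaleN1r addNr.
Qed.

Lemma lact_mul z (a b : A) : lact (f z) (a * b) = lact (f z) a * lact (f z) b.
Proof.
elim/(cqg_ind A_cqg): a => [|k a a' Ha Ha'|m u i j uu].
- by rewrite mul0r (linear_at0 (lact_linear _)) mul0r.
- by rewrite mulrDl -scalerAl !lact_linear Ha Ha' mulrDl scalerAl.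
elim/(cqg_ind A_cqg): b => [|k b b' Hb Hb'|n w k l wu].
- by rewrite mulr0 (linear_at0 (lact_linear _)) mulr0.
- by rewrite mulrDr -scalerAr !lact_linear Hb Hb' mulrDr scalerAr.
have [uc wc] : corep u /\ corep w by case: uu; case: wu.
have := lact_corep (corep_tens uc wc) (f z).
rewrite power_tens // tens_mul_sc -!lact_corep //.
move/matrixP/(_ (mxtens_index (i, k)) (mxtens_index (j, l))).
by rewrite tensmxE !mxE !mxtens_indexK.
Qed.

Lemma ract_mul z (a b : A) : ract (a * b) (f z) = ract a (f z) * ract b (f z).
Proof.
elim/(cqg_ind A_cqg): a => [|k a a' Ha Ha'|m u i j uu].
- by rewrite mul0r (linear_at0 (ract_linear _)) mul0r.
- by rewrite mulrDl -scalerAl !ract_linear Ha Ha' mulrDl scalerAl.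
elim/(cqg_ind A_cqg): b => [|k b b' Hb Hb'|n w k l wu].
- by rewrite mulr0 (linear_at0 (ract_linear _)) mulr0.
- by rewrite mulrDr -scalerAr !ract_linear Hb Hb' mulrDr scalerAr.
have [uc wc] : corep u /\ corep w by case: uu; case: wu.
have := ract_corep (corep_tens uc wc) (f z).
rewrite power_tens // tens_sc_mul -!ract_corep //.
move/matrixP/(_ (mxtens_index (i, k)) (mxtens_index (j, l))).
by rewrite tensmxE !mxE !mxtens_indexK.
Qed.

(** * The twisted involution *)

(* q plays the part of 1/4, and h that of 1/2. *)
(** * The twisted involution *)

(* The exponent 1/4, of which only these two properties matter. *)
Variable q : C.
Hypotheses (q_real : q^* = q) (q4 : q + q + (q + q) = 1).
Let h := q + q.

Definition bar (a : A) : A := ract (lact (f h) (st a)) (f (- h)).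

Lemma bar_antilinear (k : C) a b : bar (k *: a + b) = k^* *: bar a + bar b.
Proof.
rewrite /bar (starD st_star) (starZ st_star).
by rewrite lact_linear ract_linear.
Qed.

Section OneUnitary.
Variables (n : nat) (u : 'M[A]_n) (G : 'M[C]_n).
Hypotheses (uu : unitary_corep st u) (Gn : normalized u G).

Let Gp : posdef G. Proof. by case: Gn. Qed.
Let uc : corep u. Proof. by case: uu. Qed.
Let ustc : corep (map_mx st u). Proof. exact: corep_star. Qed.
Local Notation "G ^^ z" := (mxpow pow G z) (at level 30).

Let powD a b : G ^^ a *m G ^^ b = G ^^ (a + b).
Proof. by rewrite mxpowD. Qed.

Let conj_pow z : z^* = z -> map_mx Num.conj (G ^^ z) = (G ^^ z)^T.
Proof.
move=> zr; rewrite -[in RHS]zr -(mxpow_adj pow_laws) //.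
by rewrite map_trmx trmxK.
Qed.

Let hr : h^* = h. Proof. by rewrite rmorphD /= q_real. Qed.
Let Nr (z : C) : z^* = z -> (- z)^* = - z.
Proof. by move=> zr; rewrite rmorphN /= zr. Qed.

Lemma bar_unitary :
  map_mx bar u = sc (G ^^ h)^T *m map_mx st u *m sc (G ^^ (- h))^T.
Proof.
have -> : map_mx bar u =
    map_mx (fun a => ract (lact (f h) a) (f (- h))) (map_mx st u).
  by apply/matrixP => i j; rewrite !mxE.
by rewrite ract_lact_corep // !(power_star _ uu Gn) opprK.
Qed.

Lemma bar_bar_unitary : map_mx bar (map_mx bar u) = u.
Proof.
rewrite bar_unitary !(antilinear_mul_sc bar_antilinear).
rewrite !(antilinear_sc_mul bar_antilinear).
have -> : map_mx bar (map_mx st u) = sc (G ^^ (- h)) *m u *m sc (G ^^ h).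
  rewrite -!(normalized_power _ uu Gn) -ract_lact_corep //.
  by apply/matrixP => i j; rewrite !mxE /bar (starK st_star).
rewrite -!map_trmx !conj_pow ?Nr // !trmxK !mulmxA -scalmxM.
rewrite powD subrr mxpow0 // scalmx1 mul1mx -mulmxA -scalmxM powD subrr.
by rewrite mxpow0 // scalmx1 mulmx1.
Qed.

Lemma star_twist_unitary :
  map_mx st (map_mx (fun a => ract (lact (f (- q)) a) (f q)) u) =
  map_mx (fun a => ract (lact (f (- q)) a) (f q)) (map_mx bar u).
Proof.
rewrite ract_lact_corep // !(normalized_power _ uu Gn).
rewrite (antilinear_mul_sc (starP st_star)) (antilinear_sc_mul (starP st_star)).
rewrite !conj_pow ?Nr //.
rewrite bar_unitary.
have rl m p (X : 'M[C]_(m, n)) (Y : 'M[A]_n) (Z : 'M[C]_(n, p)) :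
    map_mx (fun a => ract (lact (f (- q)) a) (f q)) (sc X *m Y *m sc Z) =
    sc X *m map_mx (fun a => ract (lact (f (- q)) a) (f q)) Y *m sc Z.
  have rlin : linear (fun a => ract (lact (f (- q)) a) (f q)).
    by move=> k a b; rewrite lact_linear ract_linear.
  pose r : {linear A -> A} := HB.pack (fun a : A => ract (lact (f (- q)) a) (f q))
    (GRing.isLinear.Build C A A _ _ rlin).
  by rewrite (map_mul_sc r) (map_sc_mul r).
rewrite rl ract_lact_corep // !(power_star _ uu Gn) opprK !mulmxA -scalmxM.
rewrite -[_ *m sc _ *m sc _]mulmxA -scalmxM -!trmx_mul !powD.
have -> : - q + h = q by rewrite /h addKr.
by have -> : - h + q = - q by rewrite /h opprD addrNK.
Qed.

Lemma bar_corep : corep (map_mx bar u).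
Proof.
rewrite bar_unitary; apply: corep_conj => //; rewrite -trmx_mul powD.
  by rewrite addNr mxpow0 // trmx1.
by rewrite subrr mxpow0 // trmx1.
Qed.

Lemma bar_equiv : corep_equiv (map_mx bar u) (map_mx st u).
Proof.
have VV : (G ^^ (- h))^T *m (G ^^ h)^T = 1%:M.
  by rewrite -trmx_mul powD subrr mxpow0 // trmx1.
exists (G ^^ (- h))^T; first by case/mulmx1_unit: VV.
by rewrite bar_unitary !mulmxA -scalmxM VV scalmx1 mul1mx.
Qed.

(** Both S(u^-) and the adjoint of u^- are
    [(G^(-1/2))^T] u^T [(G^(1/2))^T]: the former by S(u* ) = S²(u)^T and
    S²(u) = [G] u [G^-1], the latter as G^(1/2) is hermitian. *)
Lemma bar_unitary_corep : unitary_corep st (map_mx bar u).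
Proof.
apply/unitaryE; split; first exact: bar_corep.
have SSu : (S (S u))^T = sc (invmx G)^T *m u^T *m sc G^T.
  have [_ Ge _] := Gn; have Gu := posdef_unit Gp.
  rewrite -tr_mul_sc -tr_sc_mul mulmxA Ge -mulmxA scalmxKV //.
  by rewrite mulmx1.
have GV : invmx G = G ^^ (- 1).
  have Gu := posdef_unit Gp; rewrite -[LHS]mul1mx -(mxpowNK pow_laws 1 Gp).
  by rewrite -mulmxA mxpow1 // mulmxV // mulmx1.
rewrite bar_unitary !(adjM st_star) !(adj_scalmx st_star).
rewrite map_mul_sc map_sc_mul (unitary_antipode_star uu) SSu GV.
rewrite -[in sc G^T](mxpow1 pow_laws Gp) !trmxK !conj_pow ?Nr //.
rewrite !mulmxA -scalmxM -[_ *m sc _ *m sc _]mulmxA -scalmxM -!trmx_mul !powD.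
have -> : -1 + h = - h by rewrite -q4 -/h opprD addrNK.
have -> : - h + 1 = h by rewrite -q4 -/h addKr.
congr (_ *m _ *m _).
by apply/matrixP => i j; rewrite !mxE (starK st_star).
Qed.

End OneUnitary.

Lemma normalized_exists n (u : 'M[A]_n) : unitary_corep st u ->
  exists G, normalized u G.
Proof. by move/has_powers_unitary => [G [Gn _]]; exists G. Qed.

Lemma bar_involution : is_involution bar.
Proof.
split; [|exact: bar_antilinear|]; last first.
  by move=> a b; rewrite /bar (starM st_star) lact_mul ract_mul.
move=> a; elim/(cqg_ind A_cqg): a => [|k a b Ha Hb|n u i j uu].
- by rewrite !(antilinear0 bar_antilinear).
- by rewrite !bar_antilinear Ha Hb conjCK.
have [G Gn] := normalized_exists uu.
by have /matrixP/(_ i j) := bar_bar_unitary uu Gn; rewrite !mxE.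
Qed.

Lemma bar_hopf_star : is_hopf_star bar.
Proof.
split; first exact: bar_involution.
  move=> a; elim/(cqg_ind A_cqg): a => [|k a b Ha Hb|n u i j uu].
  - rewrite (antilinear0 bar_antilinear) linear0.
    have := tmap_antilinear bar_antilinear 1 0 0.
    by rewrite scaler0 addr0 conjC1 scale1r -{1}[tmap _ _ _]addr0 => /addrI.
  - rewrite bar_antilinear !linearP (tmap_antilinear bar_antilinear).
    by rewrite -Ha -Hb.
  have [G Gn] := normalized_exists uu; have [bD _] := bar_corep uu Gn.
  have := bD i j; rewrite mxE => ->; have [[uD _] _] := uu.
  rewrite uD (tmap_antilinear_sum bar_antilinear).
  by apply: eq_bigr => k _; rewrite !mxE.
move=> a; elim/(cqg_ind A_cqg): a => [|k a b Ha Hb|n u i j uu].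
- by rewrite (antilinear0 bar_antilinear) linear0 conjC0.
- by rewrite bar_antilinear !counit_linear Ha Hb rmorphD rmorphM.
have [G Gn] := normalized_exists uu; have [_ be] := bar_corep uu Gn.
by have := be i j; rewrite mxE => ->; have [[_ ->] _] := uu; rewrite conjC_nat.
Qed.

Lemma star_twist a :
  st (ract (lact (f (- q)) a) (f q)) = ract (lact (f (- q)) (bar a)) (f q).
Proof.
elim/(cqg_ind A_cqg): a => [|k a b Ha Hb|n u i j uu].
- rewrite (antilinear0 bar_antilinear).
  by rewrite (linear_at0 (lact_linear _)) (linear_at0 (ract_linear _)) (star0 st_star).
- rewrite bar_antilinear !lact_linear !ract_linear (starD st_star).
  by rewrite (starZ st_star) Ha Hb.
have [G Gn] := normalized_exists uu.
by have /matrixP/(_ i j) := star_twist_unitary uu Gn; rewrite !mxE.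
Qed.

End Characters.

Theorem theorem3p5 (R : realType) (A : hopfAlgType R[i]) (st : A -> A)
    (A_cqg : is_cqg st)
    (I : Type) (d : I -> nat) (t : forall alpha : I, 'M[A]_(d alpha))
    (t_irr : irr_unitary_system st t)
    (F : forall alpha : I, 'M[R[i]]_(d alpha))
    (F_def : forall alpha, antipode2_intertwiner (t alpha) (F alpha))
    (f : R[i] -> {scalar A})
    (f_def : forall (z : R[i]) (alpha : I) (i j : 'I_(d alpha)),
       f z (t alpha i j) = mxcpow (F alpha) z i j) :
  let bar := fun a : A => ract (lact (f (1 / 2)) (st a)) (f (- (1 / 2))) in
  [/\ is_involution bar,
      forall a, st (ract (lact (f (- (1 / 4))) a) (f (1 / 4))) =
                ract (lact (f (- (1 / 4))) (bar a)) (f (1 / 4)),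
      is_hopf_star bar &
      forall (n : nat) (u : 'M[A]_n), unitary_corep st u ->
        [/\ corep (map_mx bar u), corep (map_mx st u),
            corep_equiv (map_mx bar u) (map_mx st u) &
            unitary_corep st (map_mx bar u)]].
Proof.
pose q : R[i] := 1 / 4.
have q_real : q^* = q by rewrite /q fmorph_div rmorph1 rmorph_nat.
have q4 : q + q + (q + q) = 1 by rewrite /q; field.
have -> : 1 / 2 = q + q :> R[i] by rewrite /q; field.
rewrite -/q => b; rewrite -[b]/(bar st f q) => {b}.
have pow_laws := cpow_laws R.
have f_pow z i k l : f z (t i k l) = mxpow (@cpow R) (F i) z k l by exact: f_def.
split.
- exact: (bar_involution A_cqg t_irr F_def pow_laws f_pow q_real).
- exact: (star_twist A_cqg t_irr F_def pow_laws f_pow q_real).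
- exact: (bar_hopf_star A_cqg t_irr F_def pow_laws f_pow q_real).
move=> n u uu.
have [G Gn] := normalized_exists A_cqg t_irr F_def f_pow uu.
split.
- exact: (bar_corep A_cqg t_irr F_def pow_laws f_pow q uu Gn).
- by apply: corep_star; [case: A_cqg | case: uu].
- exact: (bar_equiv A_cqg t_irr F_def pow_laws f_pow q uu Gn).
- exact: (bar_unitary_corep A_cqg t_irr F_def pow_laws f_pow q_real q4 uu Gn).
Qed.
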